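(* Let $\mathfrak s$ be a symmetry jet on a manifold $M$, let $\nabla=\nabla^{\mathfrak s}$, and let $\xi\in\mathcal B^{(1)}$ with $\alpha(\xi)=x$. Then the $(1,1,1,1)$-jet $S^{(1,1,1,1)}(\xi)=j^1_x(\mathbb S\circ a_\xi)$ is affine in the sense that for all $X,Y,Z,T\in\mathfrak X(M)$, $$\xi\bigl(\nabla_{X_x}\nabla_Y\nabla_ZT\bigr)=\nabla_{\xi X_x}\,\nabla_{a_\xi(x_1)Y_{x_1}}\,\nabla_{a^2_\xi(x_1)(x_2)Z_{x_2}}\bigl(a^3_\xi(x_1,x_2)(x_3)T_{x_3}\bigr).$$ Here the right-hand side denotes $\nabla_{\xi X_x}W$ where: for $x_1$ near $x$ and $x_2$ near $x_1$, $U_{x_1,x_2}$ is the local vector field with value $a^3_\xi(x_1,x_2)(x_3)T_{x_3}$ at $\beta(a^3_\xi(x_1,x_2)(x_3))$; $V_{x_1}$ is the local vector field with value $\nabla_{a^2_\xi(x_1)(x_2)Z_{x_2}}U_{x_1,x_2}$ at $\beta(a^2_\xi(x_1)(x_2))$; and $W$ is the local vector field with value $\nabla_{a_\xi(x_1)Y_{x_1}}V_{x_1}$ at $\beta(a_\xi(x_1))$.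
   Context: All objects are smooth. $\mathcal B^{(1)}$ is the Lie groupoid over $M$ of linear isomorphisms $\xi:T_xM\to T_yM$, source $\alpha(\xi)=x$, target $\beta(\xi)=y$; $-I_x=-\mathrm{id}_{T_xM}$. A local bisection of a Lie groupoid $G\rightrightarrows M$ is a section $b:U\to G$ of $\alpha$ over an open $U$ with $b^0:=\beta\circ b$ a diffeomorphism onto an open set; the $1$-jets $j^1_xb$ of local bisections of $G$ form a Lie groupoid over $M$. Starting from $\mathcal B^{(1)}$ and iterating this construction one obtains the groupoids of $(1,1)$-jets, $(1,1,1)$-jets and $(1,1,1,1)$-jets. For a $(1,1)$-jet $j^1_xb$ put $p(j^1_xb)=b(x)$, $p_*(j^1_xb)=(b^0)_{*_x}$; $\mathcal B^{(1,1)}_{sh}$ is the set of those with $p=p_*$. A symmetry jet is a smooth section $\mathfrak s:M\to\mathcal B^{(1,1)}_{sh}$, $\mathfrak s(x)$ being a jet at $x$ with $p(\mathfrak s(x))=-I_x$. With $(bY)_{b^0(x')}=b(x')Y_{x'}$, $(\nabla^{\mathfrak s}_XY)_x=\frac12[X,Y+s_xY]_x$ where $\mathfrak s(x)=j^1_xs_x$. Each $\xi\in\mathcal B^{(1)}$ with $\alpha(\xi)=x$ has a unique extension $S(\xi)=j^1_xa\in\mathcal B^{(1,1)}_{sh}$ with $p(S(\xi))=\xi$ that is affine: $\xi(\nabla_{X_x}Y)=\nabla_{\xi X_x}(aY)$ for all $X_x,Y$. $\mathbb S(\xi)=j^1_x(S\circ a)$ for any such $a$; it is a $(1,1,1)$-jet.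 Local bisections: $a_\xi$ denotes a local bisection of $\mathcal B^{(1)}$ near $x=\alpha(\xi)$ with $j^1_xa_\xi=S(\xi)$ (so $a_\xi(x)=\xi$). For $x_1$ near $x$, $a^2_\xi(x_1)$ is a local bisection near $x_1$, depending smoothly on $x_1$, with $a^2_\xi(x_1)(x_1)=a_\xi(x_1)$ and $j^1_{x_1}a^2_\xi(x_1)=S(a_\xi(x_1))$. For $x_2$ near $x_1$, $a^3_\xi(x_1,x_2)$ is a local bisection near $x_2$, depending smoothly on $(x_1,x_2)$, with $a^3_\xi(x_1,x_2)(x_2)=a^2_\xi(x_1)(x_2)$ and $j^1_{x_2}a^3_\xi(x_1,x_2)=S(a^2_\xi(x_1)(x_2))$. *)

(* Defs.v *)
From HB Require Import structures.
From mathcomp Require Import all_boot all_order all_algebra.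
From mathcomp Require Import all_classical all_reals all_analysis.
Import Order.TTheory GRing.Theory Num.Theory.
Import numFieldNormedType.Exports.

Set Implicit Arguments.
Unset Strict Implicit.
Unset Printing Implicit Defensive.

Local Open Scope classical_set_scope.
Local Open Scope ring_scope.

Definition choose_in (T : Type) (x0 : T) (P : set T) : T :=
  if pselect (exists x, P x) is left h then sval (cid h) else x0.

(** * Smooth maps *)

Fixpoint Cr (R : realType) (m k r : nat) (W : set 'rV[R]_m)
    (f : 'rV[R]_m -> 'rV[R]_k) : Prop :=
  match r with
  | 0 => forall u, W u -> {for u, continuous f}
  | r'.+1 => (forall u, W u -> differentiable f u) /\
             (forall v, Cr r' W (fun u => 'D_v f u))
  end.

Definition smooth_on (R : realType) (m k : nat) (W : set 'rV[R]_m)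
    (f : 'rV[R]_m -> 'rV[R]_k) : Prop :=
  open W /\ forall r, Cr r W f.

Record coordsys (R : realType) (T : Type) (m : nat) := CoordSys {
  cdom : set T;
  cmap :> T -> 'rV[R]_m }.

(* [cinv] is the inverse of [cmap]; it is meaningful on [cmap @` cdom] only. *)
Record chart (R : realType) (T : Type) (m : nat) := Chart {
  ccoord :> coordsys R T m;
  cinv : 'rV[R]_m -> T }.

Definition chart_axiom (R : realType) (T : topologicalType) (m : nat)
    (c : chart R T m) : Prop :=
  [/\ open (cdom c), open (c @` cdom c),
      forall x, cdom c x -> cinv c (c x) = x,
      forall x, cdom c x -> {for x, continuous c} &
      forall u, (c @` cdom c) u -> {for u, continuous (cinv c)}].

Record manifold (R : realType) (n : nat) := Manifold {
  mpoint :> topologicalType;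
  atlas : set (chart R mpoint n);
  manifold_hausdorff : hausdorff_space mpoint;
  manifold_second_countable : @second_countable mpoint;
  atlas_chart : forall c, atlas c -> chart_axiom c;
  atlas_cover : forall x, exists c, atlas c /\ cdom c x;
  atlas_compat : forall c d, atlas c -> atlas d ->
    smooth_on (c @` (cdom c `&` cdom d)) (fun u => d (cinv c u)) }.

Arguments atlas {R n} _.

Definition coords_of (R : realType) (T : Type) (m : nat) (A : set (chart R T m)) :
    set (coordsys R T m) := [set c : coordsys R T m | exists2 d, A d & c = d].

Definition prod_chart (R : realType) (T T' : Type) (m m' : nat)
    (c : chart R T m) (d : chart R T' m') : chart R (T * T') (m + m') :=
  Chart (CoordSys [set q | cdom c q.1 /\ cdom d q.2]
               (fun q => row_mx (c q.1) (d q.2)))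
        (fun u => (cinv c (lsubmx u), cinv d (rsubmx u))).

Definition prod_atlas (R : realType) (T T' : Type) (m m' : nat)
    (A : set (chart R T m)) (B : set (chart R T' m')) :
    set (chart R (T * T') (m + m')) :=
  [set e | exists c d, [/\ A c, B d & e = prod_chart c d]].

(* Smoothness of f : U -> T'.  The neighbourhood W of c x is mapped by
   f \o cinv c into the domain of d, so continuity of f is built in. *)
Definition smooth_map (R : realType) (T : topologicalType) (T' : Type)
    (m k : nat) (A : set (chart R T m)) (B : set (coordsys R T' k))
    (U : set T) (f : T -> T') : Prop :=
  open U /\ forall x, U x -> exists c d W,
    [/\ A c /\ cdom c x, B d /\ cdom d (f x), W (c x),
        W `<=` c @` [set y | [/\ cdom c y, U y & cdom d (f y)]] &
        smooth_on W (fun u => d (f (cinv c u)))].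

(** * Tangent vectors *)

(* T_xM is 'rV_n: a row v stands for the tangent vector at x with components
   v in the chart [chart_at x], selected once and for all at every point. *)
Section Tangent.
Variables (R : realType) (n : nat) (M : manifold R n).

Definition chart_at (x : M) : chart R M n := sval (cid (atlas_cover x)).

(* the differential at x of the coordinates c, as a map T_xM -> R^n;
   linear maps act on rows on the right *)
Definition dcoord (c : chart R M n) (x : M) : 'M[R]_n :=
  jacobian (fun u => c (cinv (chart_at x) u)) (chart_at x x).

(* f_{*x} : T_xM -> T_{f x}M *)
Definition tangent_map (f : M -> M) (x : M) : 'M[R]_n :=
  jacobian (fun u => chart_at (f x) (f (cinv (chart_at x) u))) (chart_at x x).

Definition TM_coords : set (coordsys R (M * 'rV[R]_n) (n + n)) :=
  [set d | exists2 c, atlas M c &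
     d = CoordSys [set p | cdom c p.1]
               (fun p => row_mx (c p.1) (p.2 *m dcoord c p.1))].

Definition vfield : Type := M -> 'rV[R]_n.

Definition smooth_vfield (X : vfield) : Prop :=
  smooth_map (atlas M) TM_coords setT (fun x => (x, X x)).

(* components of X in the chart c *)
Definition components (c : chart R M n) (X : vfield) (u : 'rV[R]_n) : 'rV[R]_n :=
  X (cinv c u) *m dcoord c (cinv c u).

(* [X, Y]_x = DY(X) - DX(Y) in the chart at x *)
Definition bracket (X Y : vfield) (x : M) : 'rV[R]_n :=
  let c := chart_at x in
  'd (components c Y) (c x) (X x) - 'd (components c X) (c x) (Y x).

(* the local vector field near x with value v at x and constant components in
   the chart at x *)
Definition extend (x : M) (v : 'rV[R]_n) : vfield :=
  fun y => v *m invmx (dcoord (chart_at x) y).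

End Tangent.

(** * Groupoids, local bisections and jets *)

(* A coordinate system of a groupoid G over M of the form
   g |-> (fbase (source g), fcoord g). *)
Record fchart (R : realType) (n : nat) (M : manifold R n) (G : Type)
    (src : G -> M) (k : nat) := FChart {
  fbase : chart R M n;
  fcoord :> coordsys R G k }.

(* The part of the structure of a Lie groupoid over M that local bisections and
   their jets depend on; composition and inversion do not enter. *)
Record groupoid_data (R : realType) (n : nat) (M : manifold R n) := GroupoidData {
  arrow :> Type;
  source : arrow -> M;
  target : arrow -> M;
  fdim : nat;
  fatlas : set (fchart source fdim) }.

Arguments source {R n M g}.
Arguments target {R n M g}.
Arguments fatlas {R n M} g.

Section Jets.
Variables (R : realType) (n : nat) (M : manifold R n) (G : groupoid_data M).

Definition groupoid_coords : set (coordsys R G (n + fdim G)) :=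
  [set d | exists2 c, fatlas G c &
     d = CoordSys (cdom c) (fun g => row_mx (fbase c (source g)) (c g))].

(* a map defined on [ldom]; its values elsewhere are irrelevant *)
Record local_map := LocalMap {
  ldom : set M;
  lmap :> M -> G }.

Definition base_map (b : local_map) (x : M) : M := target (b x).

Definition bisection (b : local_map) : Prop :=
  [/\ smooth_map (atlas M) groupoid_coords (ldom b) b,
      forall x, ldom b x -> source (b x) = x,
      smooth_map (atlas M) (coords_of (atlas M)) (ldom b) (base_map b),
      open (base_map b @` ldom b) &
      exists2 g : M -> M,
        smooth_map (atlas M) (coords_of (atlas M)) (base_map b @` ldom b) g &
        forall x, ldom b x -> g (base_map b x) = x].

Definition bisection_at (x : M) (b : local_map) : Prop :=
  bisection b /\ ldom b x.

Definition differential_in (c : fchart (@source _ _ _ G) (fdim G))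
    (b : local_map) (x : M) : 'M[R]_(n, fdim G) :=
  jacobian (fun u => c (b (cinv (fbase c) u))) (fbase c x).

Definition contact1 (x : M) (b b' : local_map) : Prop :=
  b x = b' x /\
  forall c, fatlas G c -> cdom c (b x) ->
    differential_in c b x = differential_in c b' x.

(* 1-jets as contact classes.  Only the elements satisfying [is_jet] are
   jets of local bisections. *)
Record jet := Jet {
  jsource : M;
  jvalue : G;
  jclass : set local_map }.

Definition j1 (x : M) (b : local_map) : jet :=
  Jet x (b x) [set b' | bisection_at x b' /\ contact1 x b b'].

Definition is_jet (j : jet) : Prop :=
  exists2 b, bisection_at (jsource j) b & j = j1 (jsource j) b.

Definition rep (j : jet) : local_map :=
  choose_in (LocalMap set0 (fun=> jvalue j))
    [set b | bisection_at (jsource j) b /\ j = j1 (jsource j) b].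

Definition jet_fchart (c : fchart (@source _ _ _ G) (fdim G)) :
    fchart jsource (fdim G + n * fdim G) :=
  FChart jsource (fbase c)
    (CoordSys [set j | is_jet j /\ cdom c (jvalue j)]
       (fun j => row_mx (c (jvalue j))
                        (mxvec (differential_in c (rep j) (jsource j))))).

End Jets.

Arguments ldom {R n M G}.

(* the groupoid of 1-jets of local bisections of G *)
Definition J1 (R : realType) (n : nat) (M : manifold R n) (G : groupoid_data M) :
    groupoid_data M :=
  @GroupoidData R n M (jet G) (@jsource _ _ _ G) (fun j => target (jvalue j))
    (fdim G + n * fdim G) [set e | exists2 c, fatlas G c & e = jet_fchart c].

Definition comp_local (R : realType) (n : nat) (M : manifold R n)
    (G H : groupoid_data M) (F : G -> H) (b : local_map G) : local_map H :=
  LocalMap (ldom b) (fun x => F (b x)).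

(** * The groupoid of linear isomorphisms of tangent spaces *)

Section FirstOrder.
Variables (R : realType) (n : nat) (M : manifold R n).

Record tangent_iso := TangentIso {
  isrc : M;
  itgt : M;
  imat : 'M[R]_n;
  imat_unit : imat \in unitmx }.

(* (x, y, matrix of xi in the charts c and d) *)
Definition iso_fchart (c d : chart R M n) : fchart isrc (n + n * n) :=
  FChart isrc c
    (CoordSys [set xi | cdom c (isrc xi) /\ cdom d (itgt xi)]
       (fun xi => row_mx (d (itgt xi))
          (mxvec (invmx (dcoord c (isrc xi)) *m imat xi
                  *m dcoord d (itgt xi))))).

Definition B1 : groupoid_data M :=
  @GroupoidData R n M tangent_iso isrc itgt (n + n * n)
    [set e | exists c d, [/\ atlas M c, atlas M d & e = iso_fchart c d]].

Definition iso_app (xi : B1) (v : 'rV[R]_n) : 'rV[R]_n := v *m imat xi.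

Fact minus_id_unit : (- 1%:M : 'M[R]_n) \in unitmx.
Proof.
apply: (proj1 (@mulmx1_unit _ _ _ (- 1%:M) _)).
by rewrite mulmxN mulmx1 opprK.
Qed.

Definition minus_id (x : M) : B1 := TangentIso x x minus_id_unit.

Definition B11 : groupoid_data M := J1 B1.
Definition B111 : groupoid_data M := J1 B11.
Definition B1111 : groupoid_data M := J1 B111.

Definition jet_p (j : B11) : B1 := jvalue j.

(* the linear map T_xM -> T_yM, with x and y the source and target of j *)
Definition jet_p_star (j : B11) : 'M[R]_n :=
  tangent_map (base_map (rep j)) (jsource j).

Definition B11sh (j : B11) : Prop := is_jet j /\ imat (jet_p j) = jet_p_star j.

Definition symmetry_jet (s : M -> B11) : Prop :=
  [/\ smooth_map (atlas M) (@groupoid_coords _ _ _ B11) setT s,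
      forall x, source (s x) = x,
      forall x, B11sh (s x) &
      forall x, jet_p (s x) = minus_id x].

(* the local vector field with value F x at b^0(x), x in the domain of b *)
Definition along (b : local_map B1) (F : M -> 'rV[R]_n) : vfield M := fun y =>
  if pselect (exists x, ldom b x /\ base_map b x = y) is left h
  then F (sval (cid h)) else 0.

(* bY *)
Definition push (b : local_map B1) (Y : vfield M) : vfield M :=
  along b (fun x => iso_app (b x) (Y x)).

(* nabla^s_X Y *)
Definition nabla (s : M -> B11) (X Y : vfield M) : vfield M := fun x =>
  2^-1 *: bracket X (fun y => Y y + push (rep (s x)) Y y) x.

(* nabla^s_v Y for v in T_xM.  As Y + s_xY vanishes at x, nabla^s is tensorial
   in X and any extension of v gives the same value. *)
Definition nabla_at (s : M -> B11) (x : M) (v : 'rV[R]_n) (Y : vfield M) :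
    'rV[R]_n := nabla s (extend x v) Y x.

Definition affine11 (s : M -> B11) (j : B11) : Prop :=
  forall a, bisection_at (source j) a -> j = j1 (source j) a ->
  forall (v : 'rV[R]_n) (Y : vfield M), smooth_vfield Y ->
    iso_app (jet_p j) (nabla_at s (source j) v Y) =
    nabla_at s (target j) (iso_app (jet_p j) v) (push a Y).

(* the affine extension of xi; it exists and is unique for a symmetry jet s *)
Definition affine_ext (s : M -> B11) (xi : B1) : B11 :=
  choose_in (j1 (source xi) (LocalMap set0 (fun=> xi)))
    [set j | [/\ B11sh j, jet_p j = xi & affine11 s j]].

(* j^1_x (affine_ext \o a), which does not depend on the choice of a *)
Definition bbS (s : M -> B11) (xi : B1) : B111 :=
  j1 (source xi) (comp_local (affine_ext s) (rep (affine_ext s xi))).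

Definition is_lift (s : M -> B11) (xi : B1) (a : local_map B1) : Prop :=
  [/\ bisection_at (source xi) a, a (source xi) = xi &
      j1 (source xi) a = affine_ext s xi].

Definition is_lift2 (s : M -> B11) (x : M) (a : local_map B1)
    (a2 : M -> local_map B1) : Prop :=
  (exists2 W : set (M * M), W (x, x) &
     (forall q, W q -> ldom (a2 q.1) q.2) /\
     smooth_map (prod_atlas (atlas M) (atlas M)) (@groupoid_coords _ _ _ B1)
       W (fun q => a2 q.1 q.2)) /\
  \forall x1 \near x, is_lift s (a x1) (a2 x1).

Definition is_lift3 (s : M -> B11) (x : M) (a2 : M -> local_map B1)
    (a3 : M -> M -> local_map B1) : Prop :=
  (exists2 W : set (M * M * M), W (x, x, x) &
     (forall q, W q -> ldom (a3 q.1.1 q.1.2) q.2) /\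
     smooth_map (prod_atlas (prod_atlas (atlas M) (atlas M)) (atlas M))
       (@groupoid_coords _ _ _ B1) W (fun q => a3 q.1.1 q.1.2 q.2)) /\
  \forall x1 \near x, \forall x2 \near x1,
    is_lift s (a2 x1 x2) (a3 x1 x2).

(* j^1_x (bbS \o a), for a = a_xi *)
Definition S1111 (s : M -> B11) (xi : B1) (a : local_map B1) : B1111 :=
  j1 (source xi) (comp_local (bbS s) a).

Definition affine1111 (s : M -> B11) (xi : B1) (J : B1111) : Prop :=
  let x := source xi in
  forall (a : local_map B1) (a2 : M -> local_map B1)
         (a3 : M -> M -> local_map B1),
    is_lift s xi a -> is_lift2 s x a a2 -> is_lift3 s x a2 a3 ->
    J = S1111 s xi a ->
  forall X Y Z T : vfield M,
    smooth_vfield X -> smooth_vfield Y -> smooth_vfield Z -> smooth_vfield T ->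
    let U x1 x2 := push (a3 x1 x2) T in
    let V x1 := along (a2 x1) (fun x2 =>
      nabla_at s (target (a2 x1 x2)) (iso_app (a2 x1 x2) (Z x2)) (U x1 x2)) in
    let W := along a (fun x1 =>
      nabla_at s (target (a x1)) (iso_app (a x1) (Y x1)) (V x1)) in
    iso_app xi (nabla_at s x (X x) (nabla s Y (nabla s Z T))) =
    nabla_at s (target xi) (iso_app xi (X x)) W.

End FirstOrder.

(* Main.v *)
Require Import Defs.
From mathcomp Require Import all_boot all_order all_algebra.
From mathcomp Require Import all_classical all_reals all_analysis.
Import Order.TTheory GRing.Theory Num.Theory.
Import numFieldNormedType.Exports.

Set Implicit Arguments.
Unset Strict Implicit.
Unset Printing Implicit Defensive.

Local Open Scope classical_set_scope.
Local Open Scope ring_scope.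

(** The lifts $a$, $a^2_{x_1}$, $a^3_{x_1,x_2}$ represent affine jets, so each
    of them intertwines one covariant derivative: $\xi(\nabla_vF) =
    \nabla_{\xi v}(aF)$ for every smooth vector field $F$, and likewise for the
    other two.  Applied to $T$, the lifts $a^3_{x_1,x_2}$ identify the field
    $V_{x_1}$ with $a^2_{x_1}(\nabla_ZT)$; applied to $\nabla_ZT$, the lifts
    $a^2_{x_1}$ identify $W$ with $a(\nabla_Y\nabla_ZT)$; applied to
    $\nabla_Y\nabla_ZT$, the lift $a$ gives the claim.  These identifications
    hold near the relevant base points only, and their sources are values
    $\nabla_{Z_{x_2}}T$ for a single tangent vector; hence the need to know that
    $\nabla$ is local in its second argument ([nabla_at_near]) and tensorial in
    its first ([nabla_at_nabla]).  Both come from the fact that $Y + s_xY$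
    vanishes at $x$, so that
    $(\nabla_XY)_x = \frac12 d(Y + s_xY)_x(X_x)$ ([nablaE]).

    Two facts make the three applications legitimate.

    First, $\nabla_ZT$ and $\nabla_Y\nabla_ZT$ have to be smooth
    ([smooth_nabla]).  Let $c$ and $d$ be charts at $x$, and let $B$ be the
    matrix of $s_x$ with respect to them.  In $(s_xY)_{s_x^0(z)} = s_x(z)Y_z$
    both $s_x(x)$ and the derivative of $s_x^0$ at the fixed point $x$ are $-1$,
    the latter because the symmetry jet lies in the set where $p = p_*$.
    Differentiating at $z = x$ therefore expresses $d(s_xY)_x$ by $dY_x$, the
    change of coordinates from $c$ to $d$ and the derivative of $B$
    ([push_rep_diff]).  The resulting formula for $\nabla_XY$ ([nabla_coord])
    involves first derivatives of $Y$ and the coordinates of the jet $s_x$, all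
    of which depend smoothly on $x$.

    Secondly, the jet [affine_ext s xi] has to be affine.  It is so as soon as
    an affine extension of [xi] exists; otherwise it is the contact class of a
    constant map.  But a lift is a bisection in that class: its coordinates
    would have zero derivative, although its base map is a local diffeomorphism
    ([not_contact_cst]).  This is absurd in positive dimension, and in dimension
    zero the assertion is an equation in a zero space. *)

(** * Differentiation of matrix-valued functions *)

Section Differentials.
Variable R : realType.

Lemma continuous_at_sum (T : topologicalType) (V : normedModType R) (I : Type)
    (r : seq I) (F : I -> T -> V) (x : T) :
  (forall i, {for x, continuous (F i)}) ->
  {for x, continuous (fun y => \sum_(i <- r) F i y)}.
Proof.
move=> Fc; elim: r => [|i r IHr].
  rewrite (_ : (fun y => _) = cst 0) //; first exact: cst_continuous.
  by apply/funext => y; rewrite big_nil.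
rewrite (_ : (fun y => _) = (fun y => F i y + \sum_(j <- r) F j y)).
  by apply: continuousD.
by apply/funext => y; rewrite big_cons.
Qed.

Lemma linear_mx_continuous (V : normedModType R) (m k : nat)
    (f : {linear 'M[R]_(m, k) -> V}) : continuous f.
Proof.
move=> A.
rewrite (_ : (f : _ -> _) =
  (fun B => \sum_(i < m) \sum_(j < k) B i j *: f (delta_mx i j))); last first.
  apply/funext => B; rewrite {1}[B]matrix_sum_delta linear_sum.
  apply: eq_bigr => i _; rewrite linear_sum; apply: eq_bigr => j _.
  by rewrite linearZ.
apply: continuous_at_sum => i; apply: continuous_at_sum => j.
apply: continuousZ; [exact: coord_continuous | exact: cst_continuous].
Qed.

Lemma mulmx_continuous (m k l : nat) :
  continuous (fun p : 'M[R]_(m, k) * 'M[R]_(k, l) => p.1 *m p.2).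
Proof.
move=> p.
rewrite (_ : (fun p : _ * _ => _) = (fun q : 'M[R]_(m, k) * 'M[R]_(k, l) =>
  \sum_(i < m) \sum_(j < l)
    (\sum_(h < k) q.1 i h * q.2 h j) *: delta_mx i j)); last first.
  apply/funext => q; rewrite {1}[q.1 *m q.2]matrix_sum_delta.
  by apply: eq_bigr => i _; apply: eq_bigr => j _; rewrite mxE.
apply: continuous_at_sum => i; apply: continuous_at_sum => j.
apply: continuousZ; last exact: cst_continuous.
apply: (@continuous_at_sum _ R^o) => h; apply: continuousM.
  by apply: (@continuous_comp _ _ _ fst (fun A : 'M[R]_(m, k) => A i h));
    [exact: cvg_fst | exact: coord_continuous].
by apply: (@continuous_comp _ _ _ snd (fun A : 'M[R]_(k, l) => A h j));
  [exact: cvg_snd | exact: coord_continuous].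
Qed.

Section Rules.
Variable V : normedModType R.

Lemma differentiable_near_eq (W : normedModType R) (f g : V -> W) (x : V) :
  (\near x, f x = g x) -> differentiable f x -> differentiable g x.
Proof.
move=> fg df.
have fgx : f x = g x by exact: nbhs_singleton fg.
(* g = f + (g - f), and g - f vanishes near x, so its differential is 0 there *)
have h0 : differentiable (g - f) x.
  pose z : {linear V -> W} := \0.
  have hz : (g - f) \o shift x = cst ((g - f) x) + z +o_ 0 id.
    apply/eqaddoP => _ /posnumP[e].
    have : \forall y \near (0 : V), f (y + x) = g (y + x).
      by move: fg; rewrite (near_shift 0) subr0.
    apply: filterS => y hy /=.
    rewrite !fctE /= hy fgx !subrr addr0 subr0 normr0.
    by rewrite mulr_ge0 ?normr_ge0.
  have zc : continuous z by move=> u; exact: cst_continuous.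
  by apply/diff_locallyP; rewrite (diff_unique zc hz); split.
rewrite (_ : g = f + (g - f)); first exact: differentiableD.
by apply/funext => y; rewrite !fctE addrC subrK.
Qed.

(** The differential depends on the germ only: even the default value that it
    takes where no differential exists is the same for both functions. *)
Lemma diff_near_eq (W : normedModType R) (f g : V -> W) (x : V) :
  (\near x, f x = g x) -> 'd f x = 'd g x :> (V -> W).
Proof.
move=> fg; have gf : \near x, g x = f x by apply: filterS fg => y ->.
have [df|ndf] := pselect (differentiable f x).
  have dg := differentiable_near_eq fg df; apply/funext => v.
  by rewrite -!deriveE //; exact: near_eq_derive.
have ndg : ~ differentiable g x by move/(differentiable_near_eq gf).
have diff_point h : ~ differentiable h x -> 'd h x = point :> {linear V -> W}.
  move=> ndh; rewrite /diff; set P := (X in get X); apply: getPN => L PL.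
  by apply: ndh; apply/diffP; exact: (@getPex _ P (ex_intro P L PL)).
by rewrite !diff_point.
Qed.

Lemma is_diff_mulmx (m k l : nat) (A : V -> 'M[R]_(m, k))
    (B : V -> 'M[R]_(k, l)) (x : V) :
  differentiable A x -> differentiable B x ->
  is_diff x (fun u => A u *m B u)
    (fun v => A x *m 'd B x v + 'd A x v *m B x).
Proof.
move=> dA dB.
have c : continuous (fun p : 'M[R]_(m, k) * 'M[R]_(k, l) => p.1 *m p.2).
  exact: mulmx_continuous.
have dp := differentiable_pair dA dB.
have dm := @differentiable_bilin _ _ _ _ (@mulmx R m k l) (A x, B x) c.
split; first exact: (differentiable_comp dp dm).
rewrite (diff_comp dp dm) (@diff_bilin _ _ _ _ (@mulmx R m k l)) //.
by rewrite (diff_pair dA dB).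
Qed.

Lemma is_diff_linear_mx (W : normedModType R) (m k : nat)
    (L : {linear 'M[R]_(m, k) -> W}) (f : V -> 'M[R]_(m, k)) (x : V) :
  differentiable f x -> is_diff x (L \o f) (L \o 'd f x).
Proof.
move=> df.
have Lc : continuous L by exact: linear_mx_continuous.
have dL := linear_differentiable (f x) Lc.
by split; [exact: differentiable_comp | rewrite diff_comp // diff_lin].
Qed.

End Rules.

Lemma diff_jacobian (m k : nat) (f : 'rV[R]_m -> 'rV[R]_k) (u v : 'rV[R]_m) :
  'd f u v = v *m jacobian f u.
Proof. by rewrite /jacobian mul_rV_lin1. Qed.

Lemma diff_comp_jacobian (W : normedModType R) (m k : nat)
    (f : 'rV[R]_m -> 'rV[R]_k) (g : 'rV[R]_k -> W) (u v : 'rV[R]_m) :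
  differentiable f u -> differentiable g (f u) ->
  'd (g \o f) u v = 'd g (f u) (v *m jacobian f u).
Proof.
move=> df dg; rewrite -(diff_jacobian f).
exact: (congr1 (@^~ v) (diff_comp df dg)).
Qed.

Lemma diff_mulmx (V : normedModType R) (m k l : nat) (A : V -> 'M[R]_(m, k))
    (B : V -> 'M[R]_(k, l)) (x v : V) :
  differentiable A x -> differentiable B x ->
  'd (fun u => A u *m B u) x v = A x *m 'd B x v + 'd A x v *m B x.
Proof.
move=> dA dB.
exact: (congr1 (@^~ v) (@diff_val _ _ _ _ _ _ _ (is_diff_mulmx dA dB))).
Qed.

Lemma jacobian_derive (m k : nat) (f : 'rV[R]_m -> 'rV[R]_k) (u : 'rV[R]_m) :
  differentiable f u ->
  jacobian f u = \sum_(i < m) (delta_mx i 0 : 'cV_m) *m 'D_(delta_mx 0 i) f u.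
Proof.
move=> df; apply/matrixP => i j; rewrite summxE (bigD1 i) //= big1.
  by rewrite addr0 deriveE // diff_jacobian -rowE [RHS]mxE big_ord1 !mxE !eqxx mul1r.
by move=> h hi; rewrite !mxE big_ord1 mxE eq_sym (negbTE hi) mul0r.
Qed.

Lemma near_eq_jacobian (m k : nat) (f g : 'rV[R]_m -> 'rV[R]_k) (u : 'rV[R]_m) :
  (\near u, f u = g u) -> jacobian f u = jacobian g u.
Proof.
move=> fg; rewrite /jacobian.
exact: (congr1 (@lin1_mx R m k) (diff_near_eq fg)).
Qed.

Lemma jacobian_comp (m k l : nat) (f : 'rV[R]_m -> 'rV[R]_k)
    (g : 'rV[R]_k -> 'rV[R]_l) (u : 'rV[R]_m) :
  differentiable f u -> differentiable g (f u) ->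
  jacobian (g \o f) u = jacobian f u *m jacobian g (f u).
Proof.
move=> df dg; rewrite /jacobian (diff_comp df dg).
move: ('d f u) ('d g (f u)) => L1 L2; apply/row_matrixP => i.
by rewrite !rowE mulmxA !mul_rV_lin1.
Qed.

Lemma jacobian_cst (m k : nat) (w : 'rV[R]_k) (u : 'rV[R]_m) :
  jacobian (fun=> w) u = 0.
Proof.
apply: etrans (congr1 (@lin1_mx R m k) (diff_cst w u)) _.
by apply/matrixP => i j; rewrite !mxE.
Qed.

Lemma jacobian_id (m : nat) (u : 'rV[R]_m) : jacobian id u = 1%:M.
Proof.
rewrite /jacobian (@diff_val _ _ _ _ _ _ _ (is_diff_id u)).
by apply/matrixP => i j; rewrite !mxE eqxx eq_sym.
Qed.

End Differentials.

(** * Germs of smooth functions on open subsets of Euclidean space *)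

Section SmoothGerms.
Variable R : realType.

(** [Cr] for functions with values in matrices of any shape, so that products of
    matrices and Jacobians stay within the class. *)
Fixpoint ck (a b m r : nat) (W : set 'rV[R]_m) (f : 'rV[R]_m -> 'M[R]_(a, b)) :
    Prop :=
  match r with
  | 0 => forall u, W u -> {for u, continuous f}
  | r'.+1 => (forall u, W u -> differentiable f u) /\
             (forall v, ck r' W (fun u => 'D_v f u))
  end.

Lemma ckE (k m r : nat) (W : set 'rV[R]_m) (f : 'rV[R]_m -> 'rV[R]_k) :
  ck r W f <-> Cr r W f.
Proof.
elim: r f => //= r IHr f.
by split=> -[df Df]; split=> // v; apply/IHr/Df.
Qed.

Section FixedDomain.
Variables (m : nat) (W : set 'rV[R]_m).

Lemma ckW (a b r : nat) (f : 'rV[R]_m -> 'M[R]_(a, b)) :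
  ck r.+1 W f -> ck r W f.
Proof.
elim: r f => [|r IHr] f [df Df].
  by move=> u Wu; apply: differentiable_continuous; exact: df.
by split=> // v; apply: IHr; exact: Df.
Qed.

Lemma ck_cst (a b r : nat) (A : 'M[R]_(a, b)) : ck r W (cst A).
Proof.
elim: r A => [|r IHr] A; first by move=> u _; exact: cst_continuous.
split=> [u _|v]; first exact: differentiable_cst.
rewrite (_ : (fun u => _) = cst 0) //.
by apply/funext => u; rewrite derive_cst.
Qed.

Lemma ck_id (r : nat) : ck r W (@id 'rV[R]_m).
Proof.
case: r => [|r]; first by move=> u _ A.
split=> [u _|v]; first exact: (@ex_diff _ _ _ _ _ _ _ (is_diff_id u)).
rewrite (_ : (fun u => _) = cst v); first exact: ck_cst.
by apply/funext => u; rewrite derive_id.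
Qed.

Lemma ck_sub (V : set 'rV[R]_m) (a b r : nat) (f : 'rV[R]_m -> 'M[R]_(a, b)) :
  V `<=` W -> ck r W f -> ck r V f.
Proof.
move=> VW; elim: r f => [|r IHr] f; first by move=> cf u /VW; exact: cf.
by move=> [df Df]; split=> [u /VW|v]; [exact: df | exact: IHr (Df v)].
Qed.

Hypothesis openW : open W.

Lemma near_open (P : 'rV[R]_m -> Prop) :
  (forall u, W u -> P u) -> forall u, W u -> \near u, P u.
Proof.
move=> WP u Wu; have : nbhs u W by exact: open_nbhs_nbhs.
by apply: filterS => v /WP.
Qed.

Lemma ck_ext (a b r : nat) (f g : 'rV[R]_m -> 'M[R]_(a, b)) :
  (forall u, W u -> f u = g u) -> ck r W f -> ck r W g.
Proof.
elim: r f g => [|r IHr] f g fg.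
  move=> fc u Wu; have nfg := near_open fg Wu.
  rewrite /continuous_at /prop_for -(fg u Wu).
  by apply: cvg_trans (fc u Wu); exact: (near_eq_cvg nfg).
move=> [df Df]; split=> [u Wu|v].
  exact: (differentiable_near_eq (near_open fg Wu) (df u Wu)).
apply: IHr (Df v) => u Wu; apply: near_eq_derive; exact: near_open.
Qed.

Lemma ckD (a b r : nat) (f g : 'rV[R]_m -> 'M[R]_(a, b)) :
  ck r W f -> ck r W g -> ck r W (fun u => f u + g u).
Proof.
elim: r f g => [|r IHr] f g.
  by move=> cf cg u Wu; apply: continuousD; [exact: cf | exact: cg].
move=> [df Df] [dg Dg]; split=> [u Wu|v].
  by apply: differentiableD; [exact: df | exact: dg].
apply: ck_ext (IHr _ _ (Df v) (Dg v)) => u Wu /=.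
by rewrite deriveD //; apply: diff_derivable; [exact: df | exact: dg].
Qed.

Lemma ck_sum (a b r : nat) (I : Type) (s : seq I)
    (f : I -> 'rV[R]_m -> 'M[R]_(a, b)) :
  (forall i, ck r W (f i)) -> ck r W (fun u => \sum_(i <- s) f i u).
Proof.
move=> cf; elim: s => [|i s IHs].
  by apply: ck_ext (ck_cst r 0) => u _; rewrite big_nil.
by apply: ck_ext (ckD (cf i) IHs) => u _; rewrite big_cons.
Qed.

Lemma ck_linear (a b c d r : nat) (L : {linear 'M[R]_(a, b) -> 'M[R]_(c, d)})
    (f : 'rV[R]_m -> 'M[R]_(a, b)) : ck r W f -> ck r W (fun u => L (f u)).
Proof.
elim: r f => [|r IHr] f.
  move=> cf u Wu; apply: continuous_comp; first exact: cf.
  exact: linear_mx_continuous.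
move=> [df Df]; have H u (Wu : W u) := is_diff_linear_mx L (df u Wu).
split=> [u Wu|v]; first exact: (@ex_diff _ _ _ _ _ _ _ (H u Wu)).
apply: ck_ext (IHr _ (Df v)) => u Wu /=.
rewrite [RHS]deriveE; last exact: (@ex_diff _ _ _ _ _ _ _ (H u Wu)).
by rewrite (@diff_val _ _ _ _ _ _ _ (H u Wu)) /= deriveE //; exact: df.
Qed.

Lemma ckM (a b c r : nat) (f : 'rV[R]_m -> 'M[R]_(a, b))
    (g : 'rV[R]_m -> 'M[R]_(b, c)) :
  ck r W f -> ck r W g -> ck r W (fun u => f u *m g u).
Proof.
elim: r f g => [|r IHr] f g.
  move=> cf cg u Wu.
  apply: (@continuous_comp _ _ _ (fun u => (f u, g u)) (fun p => p.1 *m p.2)).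
    exact: (cvg_pair (cf u Wu) (cg u Wu)).
  exact: mulmx_continuous.
move=> cf cg; have [df Df] := cf; have [dg Dg] := cg.
have H u (Wu : W u) := is_diff_mulmx (df u Wu) (dg u Wu).
split=> [u Wu|v]; first exact: (@ex_diff _ _ _ _ _ _ _ (H u Wu)).
have /ck_ext := ckD (IHr _ _ (ckW cf) (Dg v)) (IHr _ _ (Df v) (ckW cg)).
apply=> u Wu /=; rewrite [RHS]deriveE.
  by rewrite (@diff_val _ _ _ _ _ _ _ (H u Wu)) !deriveE //;
    [exact: df | exact: dg].
exact: (@ex_diff _ _ _ _ _ _ _ (H u Wu)).
Qed.

End FixedDomain.

Lemma ck_comp (m k a b r : nat) (W : set 'rV[R]_m) (W' : set 'rV[R]_k)
    (f : 'rV[R]_m -> 'rV[R]_k) (g : 'rV[R]_k -> 'M[R]_(a, b)) :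
  open W -> (forall u, W u -> W' (f u)) -> ck r W f -> ck r W' g ->
  ck r W (fun u => g (f u)).
Proof.
move=> openW WW'; elim: r g => [|r IHr] g.
  move=> cf cg u Wu; apply: (@continuous_comp _ _ _ f g); first exact: cf.
  by apply: cg; exact: WW'.
move=> cf [dg Dg]; have [df Df] := cf.
have dgf u (Wu : W u) : differentiable (g \o f) u.
  by apply: differentiable_comp; [exact: df | apply/dg/WW'].
split=> [u Wu|v]; first exact: dgf.
(* The chain rule writes the derivative as v |-> 'D_v f times the matrix whose
   rows are the flattened partial derivatives of g: a product of functions that
   are r times differentiable by induction. *)
pose rows (u : 'rV[R]_m) : 'M[R]_(k, a * b) :=
  \sum_(i < k) (delta_mx i 0 : 'cV_k) *m mxvec ('D_(delta_mx 0 i) g (f u)).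
have crows : ck r W rows.
  apply: ck_sum => // i; apply: ckM => //; first exact: ck_cst.
  by apply: ck_linear => //; apply: IHr (Dg _); exact: ckW.
have /ck_ext := ck_linear openW vec_mx (ckM openW (Df v) crows).
apply=> // u Wu /=; rewrite [RHS]deriveE; last exact: dgf.
rewrite [RHS](_ : _ = 'd g (f u) ('D_v f u)); last first.
  rewrite diff_comp; [|exact: df|by apply/dg/WW'].
  by rewrite /= deriveE //; exact: df.
rewrite [in RHS](row_sum_delta ('D_v f u)) /rows !linear_sum /=.
apply: eq_bigr => i _; rewrite linearZ /= -deriveE; last by apply/dg/WW'.
by rewrite mulmxA -colE [col i _]mx11_scalar mxE mul_scalar_mx linearZ /= mxvecK.
Qed.

Lemma ck_jacobian (m k r : nat) (W : set 'rV[R]_m) (f : 'rV[R]_m -> 'rV[R]_k) :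
  open W -> ck r.+1 W f -> ck r W (jacobian f).
Proof.
move=> openW [df Df].
have /ck_ext : ck r W (fun u =>
    \sum_(i < m) (delta_mx i 0 : 'cV_m) *m 'D_(delta_mx 0 i) f u).
  by apply: ck_sum => // i; apply: ckM => //; [exact: ck_cst | exact: Df].
by apply=> // u Wu; rewrite jacobian_derive //; exact: df.
Qed.

Definition smooth_at (a b m : nat) (p : 'rV[R]_m) (f : 'rV[R]_m -> 'M[R]_(a, b)) :
    Prop :=
  exists W, [/\ open W, W p & forall r, ck r W f].

Section SmoothAt.
Variables (m : nat) (p : 'rV[R]_m).

Lemma smooth_at_differentiable (a b : nat) (f : 'rV[R]_m -> 'M[R]_(a, b)) :
  smooth_at p f -> differentiable f p.
Proof. by move=> [W [_ Wp /(_ 1%N) [df _]]]; exact: df. Qed.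

Lemma smooth_at_continuous (a b : nat) (f : 'rV[R]_m -> 'M[R]_(a, b)) :
  smooth_at p f -> {for p, continuous f}.
Proof. by move=> [W [_ Wp /(_ 0%N)]]; exact. Qed.

Lemma smooth_at_ext (a b : nat) (f g : 'rV[R]_m -> 'M[R]_(a, b)) :
  (\near p, f p = g p) -> smooth_at p f -> smooth_at p g.
Proof.
move=> fg [W [oW Wp cf]].
have [V [oV Vp] VE] : exists2 V, open_nbhs p V & V `<=` [set u | f u = g u].
  by move: fg; rewrite -nbhs_nearE nbhsE.
exists (W `&` V); split=> [||r]; [exact: openI | by [] |].
apply: (ck_ext (openI oW oV) (f := f)) => [u [_ /VE] //|].
by apply: ck_sub (cf r) => u [].
Qed.

Lemma smooth_at_cst (a b : nat) (A : 'M[R]_(a, b)) : smooth_at p (cst A).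
Proof. by exists setT; split=> [||r]; [exact: openT | by [] | exact: ck_cst]. Qed.

Lemma smooth_at_id : smooth_at p id.
Proof. by exists setT; split=> [||r]; [exact: openT | by [] | exact: ck_id]. Qed.

Lemma smooth_atD (a b : nat) (f g : 'rV[R]_m -> 'M[R]_(a, b)) :
  smooth_at p f -> smooth_at p g -> smooth_at p (fun u => f u + g u).
Proof.
move=> [W [oW Wp cf]] [V [oV Vp cg]]; have oWV := openI oW oV.
exists (W `&` V); split=> // r.
by apply: ckD => //; [apply: ck_sub (cf r) | apply: ck_sub (cg r)] => u [].
Qed.

Lemma smooth_atM (a b c : nat) (f : 'rV[R]_m -> 'M[R]_(a, b))
    (g : 'rV[R]_m -> 'M[R]_(b, c)) :
  smooth_at p f -> smooth_at p g -> smooth_at p (fun u => f u *m g u).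
Proof.
move=> [W [oW Wp cf]] [V [oV Vp cg]]; have oWV := openI oW oV.
exists (W `&` V); split=> // r.
by apply: ckM => //; [apply: ck_sub (cf r) | apply: ck_sub (cg r)] => u [].
Qed.

Lemma smooth_at_linear (a b c d : nat)
    (L : {linear 'M[R]_(a, b) -> 'M[R]_(c, d)})
    (f : 'rV[R]_m -> 'M[R]_(a, b)) :
  smooth_at p f -> smooth_at p (fun u => L (f u)).
Proof.
by move=> [W [oW Wp cf]]; exists W; split=> // r; exact: ck_linear.
Qed.

Lemma smooth_at_jacobian (k : nat) (f : 'rV[R]_m -> 'rV[R]_k) :
  smooth_at p f -> smooth_at p (jacobian f).
Proof.
by move=> [W [oW Wp cf]]; exists W; split=> // r; exact: ck_jacobian.
Qed.

Lemma smooth_at_comp (k a b : nat) (f : 'rV[R]_m -> 'rV[R]_k)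
    (g : 'rV[R]_k -> 'M[R]_(a, b)) :
  smooth_at p f -> smooth_at (f p) g -> smooth_at p (fun u => g (f u)).
Proof.
move=> sf [V [oV Vfp cg]]; have fc := smooth_at_continuous sf.
have [W [oW Wp cf]] := sf.
have [U [oU Up] UV] : exists2 U, open_nbhs p U & U `<=` f @^-1` V.
  by move: (fc V (open_nbhs_nbhs (conj oV Vfp))); rewrite nbhsE.
exists (W `&` U); split=> [||r]; [exact: openI | by [] |].
apply: (@ck_comp _ _ _ _ _ _ V) (cg r); first exact: openI.
  by move=> u [_ /UV].
by apply: ck_sub (cf r) => u [].
Qed.

End SmoothAt.

End SmoothGerms.

(** * Charts and changes of coordinates *)

Section Charts.
Variables (R : realType) (n : nat) (M : manifold R n).
Implicit Types (c d e : chart R M n) (x y : M).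

Lemma chart_atP x : atlas M (chart_at x) /\ cdom (chart_at x) x.
Proof. exact: svalP (cid (atlas_cover x)). Qed.

Lemma cinvK c x : atlas M c -> cdom c x -> cinv c (c x) = x.
Proof. by move=> /atlas_chart[_ _ cK _ _] /cK. Qed.

Lemma near_cdom c x : atlas M c -> cdom c x -> \forall y \near x, cdom c y.
Proof.
by move=> /atlas_chart[oc _ _ _ _] cx; apply: open_nbhs_nbhs.
Qed.

Lemma near_coord c x (P : 'rV[R]_n -> Prop) : atlas M c -> cdom c x ->
  (\forall u \near c x, P u) -> \forall y \near x, P (c y).
Proof. by move=> /atlas_chart[_ _ _ cc _] /cc; apply. Qed.

Lemma near_cinv c x (P : M -> Prop) : atlas M c -> cdom c x ->
  (\forall y \near x, P y) -> \forall u \near c x, P (cinv c u).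
Proof.
move=> Ac cx Px; have /atlas_chart[_ _ _ _ cic] := Ac.
apply: (cic (c x) _ P); first by exists x.
by rewrite cinvK.
Qed.

Lemma near_image c x : atlas M c -> cdom c x ->
  \forall u \near c x, cdom c (cinv c u) /\ c (cinv c u) = u.
Proof.
move=> Ac cx; have /atlas_chart[_ oc _ _ _] := Ac.
have : nbhs (c x) (c @` cdom c) by apply: open_nbhs_nbhs; split=> //; exists x.
by apply: filterS => u [y cy <-]; rewrite !cinvK.
Qed.

Lemma transition_smooth c d x :
  atlas M c -> atlas M d -> cdom c x -> cdom d x ->
  smooth_at (c x) (fun u => d (cinv c u)).
Proof.
move=> Ac Ad cx dx; have [oW cW] := atlas_compat Ac Ad.
exists (c @` (cdom c `&` cdom d)); split=> //; first by exists x.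
by move=> r; apply/ckE.
Qed.

Lemma smooth_at_rechart (a b : nat) (F : M -> 'M[R]_(a, b)) c d x :
  atlas M c -> atlas M d -> cdom c x -> cdom d x ->
  smooth_at (c x) (fun u => F (cinv c u)) ->
  smooth_at (d x) (fun u => F (cinv d u)).
Proof.
move=> Ac Ad cx dx sF.
have := smooth_at_comp (transition_smooth Ad Ac dx cx).
move=> /(_ _ _ (fun u => F (cinv c u))); rewrite cinvK // => /(_ sF).
apply: smooth_at_ext.
by have := near_cinv Ad dx (near_cdom Ac cx); apply: filterS => u /(cinvK Ac)->.
Qed.

(** Smoothness is tested in the chart selected at [x]; by [smoothM_atP] any
    other chart gives the same notion. *)
Definition smoothM_at (a b : nat) x (F : M -> 'M[R]_(a, b)) : Prop :=
  smooth_at (chart_at x x) (fun u => F (cinv (chart_at x) u)).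

Lemma smoothM_atP (a b : nat) (F : M -> 'M[R]_(a, b)) c x :
  atlas M c -> cdom c x ->
  smoothM_at x F <-> smooth_at (c x) (fun u => F (cinv c u)).
Proof.
have [A0 x0] := chart_atP x.
by move=> Ac cx; split; exact: smooth_at_rechart.
Qed.

Lemma smoothM_at_ext (a b : nat) (F G : M -> 'M[R]_(a, b)) x :
  (\forall y \near x, F y = G y) -> smoothM_at x F -> smoothM_at x G.
Proof.
have [A0 x0] := chart_atP x.
by move=> /(near_cinv A0 x0) FG; exact: smooth_at_ext.
Qed.

Lemma smoothM_atD (a b : nat) (F G : M -> 'M[R]_(a, b)) x :
  smoothM_at x F -> smoothM_at x G -> smoothM_at x (fun y => F y + G y).
Proof. exact: smooth_atD. Qed.

Lemma smoothM_atM (a b k : nat) (F : M -> 'M[R]_(a, b))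
    (G : M -> 'M[R]_(b, k)) x :
  smoothM_at x F -> smoothM_at x G -> smoothM_at x (fun y => F y *m G y).
Proof. exact: smooth_atM. Qed.

Lemma smoothM_at_linear (a b k l : nat)
    (L : {linear 'M[R]_(a, b) -> 'M[R]_(k, l)}) (F : M -> 'M[R]_(a, b)) x :
  smoothM_at x F -> smoothM_at x (fun y => L (F y)).
Proof. exact: smooth_at_linear. Qed.

Lemma smoothM_at_comp (k a b : nat) x (f : M -> 'rV[R]_k)
    (g : 'rV[R]_k -> 'M[R]_(a, b)) :
  smoothM_at x f -> smooth_at (f x) g -> smoothM_at x (fun y => g (f y)).
Proof.
have [A0 x0] := chart_atP x.
by move=> sf sg; apply: smooth_at_comp sf _; rewrite cinvK.
Qed.

Lemma smoothM_at_row_mx (a b k : nat) (F : M -> 'M[R]_(a, b))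
    (G : M -> 'M[R]_(a, k)) x :
  smoothM_at x F -> smoothM_at x G ->
  smoothM_at x (fun y => row_mx (F y) (G y)).
Proof.
have sc (l m : nat) (A : 'M[R]_(l, m)) : smoothM_at x (fun=> A).
  exact: smooth_at_cst.
move=> sF sG.
have := smoothM_atD (smoothM_atM sF (sc _ _ (row_mx 1%:M 0)))
                    (smoothM_atM sG (sc _ _ (row_mx 0 1%:M))).
apply: smoothM_at_ext; near=> y.
by rewrite !mul_mx_row !mulmx1 !mulmx0 add_row_mx addr0 add0r.
Unshelve. all: by end_near. Qed.

Lemma smoothM_at_coord c x (a b : nat) (f : 'rV[R]_n -> 'M[R]_(a, b)) :
  atlas M c -> cdom c x -> smooth_at (c x) f -> smoothM_at x (fun y => f (c y)).
Proof.
move=> Ac cx sf; apply/(smoothM_atP _ Ac cx); apply: smooth_at_ext sf.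
by have := near_image Ac cx; apply: filterS => u [_ ->].
Qed.

(** The matrix of the identity of $T_xM$ with respect to the bases given by
    [c] and by [d]. *)
Definition trans c d x : 'M[R]_n := jacobian (fun u => d (cinv c u)) (c x).

Lemma trans_comp c d e x :
  atlas M c -> atlas M d -> atlas M e -> cdom c x -> cdom d x -> cdom e x ->
  trans c e x = trans c d x *m trans d e x.
Proof.
move=> Ac Ad Ae cx dx ex; rewrite /trans.
have dcd := smooth_at_differentiable (transition_smooth Ac Ad cx dx).
have dde : differentiable (fun u => e (cinv d u)) (d (cinv c (c x))).
  rewrite cinvK //.
  exact: smooth_at_differentiable (transition_smooth Ad Ae dx ex).
have J := jacobian_comp dcd dde.
rewrite (cinvK Ac cx) in J.
rewrite -J.
apply/esym/near_eq_jacobian.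
have := near_cinv Ac cx (near_cdom Ad dx).
by apply: filterS => u /(cinvK Ad) /= ->.
Qed.

Lemma trans_id c x : atlas M c -> cdom c x -> trans c c x = 1%:M.
Proof.
move=> Ac cx; rewrite /trans -(jacobian_id (c x)).
apply: near_eq_jacobian.
by have := near_image Ac cx; apply: filterS => u [_ ->].
Qed.

Lemma trans_inv c d x : atlas M c -> atlas M d -> cdom c x -> cdom d x ->
  trans c d x *m trans d c x = 1%:M.
Proof. by move=> *; rewrite -trans_comp // trans_id. Qed.

Lemma trans_smooth c d x : atlas M c -> atlas M d -> cdom c x -> cdom d x ->
  smoothM_at x (trans c d).
Proof.
move=> Ac Ad cx dx; apply: (smoothM_at_coord Ac cx).
exact/smooth_at_jacobian/transition_smooth.
Qed.

Lemma dcoord_trans c d x : atlas M c -> atlas M d -> cdom c x -> cdom d x ->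
  dcoord c x *m trans c d x = dcoord d x.
Proof.
move=> Ac Ad cx dx; have [A0 x0] := chart_atP x.
exact/esym/(trans_comp A0 Ac Ad x0 cx dx).
Qed.

Lemma dcoord_unit c x : atlas M c -> cdom c x -> dcoord c x \in unitmx.
Proof.
move=> Ac cx; have [A0 x0] := chart_atP x.
exact: proj2 (mulmx1_unit (trans_inv Ac A0 cx x0)).
Qed.

Lemma dcoord_chart_at x : dcoord (chart_at x) x = 1%:M.
Proof. by have [A0 x0] := chart_atP x; exact: trans_id. Qed.

Lemma transE c d x : atlas M c -> atlas M d -> cdom c x -> cdom d x ->
  trans c d x = invmx (dcoord c x) *m dcoord d x.
Proof.
move=> Ac Ad cx dx; rewrite -(dcoord_trans Ac Ad cx dx) mulKmx //.
exact: dcoord_unit.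
Qed.

Lemma trans_chart_at c x : atlas M c -> cdom c x ->
  trans c (chart_at x) x = invmx (dcoord c x).
Proof.
move=> Ac cx; have [A0 x0] := chart_atP x.
by rewrite (transE Ac A0 cx x0) dcoord_chart_at mulmx1.
Qed.

(** The continuity that [smooth_map] builds into its choice of coordinates
    extends that choice to a neighbourhood of the point. *)
Lemma smooth_map_at (T : Type) (k : nat) (B : set (coordsys R T k))
    (U : set M) (f : M -> T) x :
  smooth_map (atlas M) B U f -> U x ->
  exists b : coordsys R T k,
    [/\ B b, \forall y \near x, cdom b (f y) &
        smoothM_at x (fun y => b (f y))].
Proof.
move=> [_ H] /H[c [d [W [[Ac cx] [Bd dfx] Wcx Wsub [oW cW]]]]].
exists d; split=> //; last first.
  apply/(smoothM_atP _ Ac cx); exists W; split=> // r.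
  exact/ckE.
have : \forall u \near c x, W u by exact: open_nbhs_nbhs.
move=> /(near_coord Ac cx) nW; near=> y.
have cy : cdom c y by near: y; exact: near_cdom.
have [|z [cz _ dz] zy] := Wsub (c y); first by near: y.
by rewrite -(cinvK Ac cy) -zy cinvK.
Unshelve. all: by end_near. Qed.

Lemma smooth_map_coord (U : set M) (f : M -> M) d x :
  smooth_map (atlas M) (coords_of (atlas M)) U f -> U x ->
  atlas M d -> cdom d (f x) -> smoothM_at x (fun y => d (f y)).
Proof.
move=> sf Ux Ad dfx; have [d' [[e Ae eE] nd sd]] := smooth_map_at sf Ux.
subst d'; have efx : cdom e (f x) by exact: nbhs_singleton nd.
apply: smoothM_at_ext (smoothM_at_comp sd (transition_smooth Ae Ad efx dfx)).
by apply: filterS nd => y /(cinvK Ae)->.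
Qed.

Lemma smooth_map_continuous (U : set M) (f : M -> M) x :
  smooth_map (atlas M) (coords_of (atlas M)) U f -> U x ->
  {for x, continuous f}.
Proof.
move=> sf Ux; have [A0 x0] := chart_atP x; have [A1 fx1] := chart_atP (f x).
have [_ [[e Ae ->] nd sd]] := smooth_map_at sf Ux.
have efx : cdom e (f x) by exact: nbhs_singleton nd.
move=> P /= Pfx.
have := near_cinv Ae efx Pfx.
have := smooth_at_continuous sd; rewrite /prop_for /continuous_at cinvK //.
move=> ec /ec /(near_coord A0 x0) H.
apply: filterS (filterI (filterI H (near_cdom A0 x0)) nd) => y [[Py cy] ey].
by move: Py; rewrite /= (cinvK A0 cy) (cinvK Ae ey).
Qed.

End Charts.

(** * Vector fields in coordinates *)

Section VectorFields.
Variables (R : realType) (n : nat) (M : manifold R n).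
Implicit Types (c d e : chart R M n) (x y : M) (X Y : vfield M).

Lemma smooth_components X d x : atlas M d -> cdom d x ->
  smoothM_at x (fun y => X y *m dcoord d y) <->
  smooth_at (d x) (components d X).
Proof. by move=> Ad dx; exact: smoothM_atP. Qed.

Lemma smooth_components_rechart X c d x :
  atlas M c -> atlas M d -> cdom c x -> cdom d x ->
  smoothM_at x (fun y => X y *m dcoord c y) ->
  smoothM_at x (fun y => X y *m dcoord d y).
Proof.
move=> Ac Ad cx dx sX.
have := smoothM_atM sX (trans_smooth Ac Ad cx dx); apply: smoothM_at_ext.
near=> y; rewrite -mulmxA dcoord_trans //; near: y; exact: near_cdom.
Unshelve. all: by end_near. Qed.

Lemma smooth_vfield_at X d x : smooth_vfield X -> atlas M d -> cdom d x ->
  smoothM_at x (fun y => X y *m dcoord d y).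
Proof.
move=> sX Ad dx; have [_ [[e Ae ->] ex sm]] := smooth_map_at (x := x) sX I.
apply: (smooth_components_rechart Ae Ad) => //.
  exact: (nbhs_singleton ex).
have := smoothM_at_linear (@rsubmx R 1 n n) sm; apply: smoothM_at_ext.
by apply: nearW => y; rewrite /= row_mxKr.
Qed.

Lemma smooth_vfieldI X :
  (forall x, exists d, [/\ atlas M d, cdom d x &
     smoothM_at x (fun y => X y *m dcoord d y)]) -> smooth_vfield X.
Proof.
move=> H; split=> [|x _]; first exact: openT.
have [d [Ad dx sX]] := H x.
have sd : smoothM_at x d by exact: (smoothM_at_coord Ad dx (@smooth_at_id _ _ _)).
have /(smoothM_atP _ Ad dx)[W [oW Wx cW]] := smoothM_at_row_mx sd sX.
have /atlas_chart[_ oi _ _ _] := Ad; have oWi := openI oW oi.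
pose D := CoordSys [set p : M * 'rV[R]_n | cdom d p.1]
            (fun p => row_mx (d p.1) (p.2 *m dcoord d p.1)).
exists (ccoord d), D, (W `&` d @` cdom d); split=> //.
- by split=> //; exists d.
- by split=> //; exists x.
- by move=> _ [_ [y dy <-]]; exists y.
- by split=> // r; apply/ckE; apply: ck_sub (cW r) => u [].
Qed.

(** Differentiating [X_d = X_c * trans c d], the term containing the derivative
    of the transition matrix drops out where [X] vanishes: the derivative of a
    vector field at a zero is a well-defined endomorphism of the tangent
    space. *)
Lemma diff_components_zero X d x (v : 'rV[R]_n) :
  atlas M d -> cdom d x -> smoothM_at x (fun y => X y *m dcoord d y) ->
  X x = 0 ->
  'd (components (chart_at x) X) (chart_at x x) v *m dcoord d x =
  'd (components d X) (d x) (v *m dcoord d x).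
Proof.
move=> Ad dx sX X0; set c := chart_at x.
have [Ac cx] : atlas M c /\ cdom c x by exact: chart_atP.
have sXc := smooth_components_rechart Ad Ac dx cx sX.
have dXd : differentiable (components d X) (d x).
  by apply: smooth_at_differentiable; apply/smooth_components.
have dXc : differentiable (components c X) (c x).
  by apply: smooth_at_differentiable; apply/smooth_components.
have dphi := smooth_at_differentiable (transition_smooth Ac Ad cx dx).
have /smooth_at_differentiable dT :
    smooth_at (c x) (fun u => trans c d (cinv c u)).
  by apply/(smoothM_atP _ Ac cx); exact: trans_smooth.
pose phi u := d (cinv c u).
pose h u := components c X u *m trans c d (cinv c u).
have E : \forall u \near c x, (components d X \o phi) u = h u.
  have H := near_cinv Ac cx (near_cdom Ad dx).
  apply: filterS (filterI H (near_image Ac cx)) => u [du [cu _]].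
  by rewrite /phi /h /= /components (cinvK Ad du) -mulmxA (dcoord_trans Ac Ad cu du).
have dXd' : differentiable (components d X) (phi (c x)).
  by rewrite /phi (cinvK Ac cx).
have := etrans (esym (diff_comp_jacobian v dphi dXd'))
  (etrans (congr1 (@^~ v) (diff_near_eq E)) (diff_mulmx v dXc dT)).
have X0' : components c X (c x) = 0.
  by rewrite /components (cinvK Ac cx) X0 mul0mx.
by rewrite /= X0' mul0mx add0r (cinvK Ac cx) => /esym.
Qed.

(** The other term of the bracket is the derivative of [X] along [Y x]. *)
Lemma bracket_zero X Y x : Y x = 0 ->
  bracket X Y x = 'd (components (chart_at x) Y) (chart_at x x) (X x).
Proof.
move=> Y0; rewrite /bracket Y0; apply: etrans (subr0 _).
exact: (congr1 (fun w => 'd _ _ (X x) - w) (linear0 _)).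
Qed.

Lemma smooth_map_coord_jacobian (U : set M) (f : M -> M) c d x :
  smooth_map (atlas M) (coords_of (atlas M)) U f -> U x ->
  atlas M c -> cdom c x -> atlas M d -> cdom d (f x) ->
  jacobian (fun u => d (f (cinv c u))) (c x) =
  invmx (dcoord c x) *m tangent_map f x *m dcoord d (f x).
Proof.
move=> sf Ux Ac cx Ad dfx.
have [A0 x0] := chart_atP x; have [A1 fx1] := chart_atP (f x).
set c0 := chart_at x in A0 x0 *; set d0 := chart_at (f x) in A1 fx1 *.
pose phi u := c0 (cinv c u); pose F u := d0 (f (cinv c0 u)).
pose psi v := d (cinv d0 v).
have phix : phi (c x) = c0 x by rewrite /phi (cinvK Ac cx).
have Fx : F (phi (c x)) = d0 (f x) by rewrite phix /F (cinvK A0 x0).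
have dphi : differentiable phi (c x).
  exact: smooth_at_differentiable (transition_smooth Ac A0 cx x0).
have dF : differentiable F (phi (c x)).
  rewrite phix; apply: smooth_at_differentiable.
  have /(smoothM_atP _ A0 x0) := smooth_map_coord sf Ux A1 fx1; exact.
have dpsi : differentiable psi (F (phi (c x))).
  by rewrite Fx; exact: smooth_at_differentiable (transition_smooth A1 Ad _ _).
have E : \forall u \near c x, d (f (cinv c u)) = (psi \o (F \o phi)) u.
  have cf := smooth_map_continuous sf Ux.
  have H := near_cinv Ac cx (cf _ (near_cdom A1 fx1)).
  apply: filterS (filterI H (near_cinv Ac cx (near_cdom A0 x0))) => u [d0u c0u].
  by rewrite /psi /F /phi /= (cinvK A0 c0u) (cinvK A1 d0u).
have J1 := jacobian_comp dphi dF.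
have J2 := jacobian_comp (differentiable_comp dphi dF) dpsi.
rewrite (near_eq_jacobian E); apply: etrans J2 _; rewrite J1 phix.
rewrite -[(F \o phi) (c x)]/(F (phi (c x))) Fx.
exact: (congr1 (fun A => A *m jacobian F (c0 x) *m jacobian psi (d0 (f x)))
              (trans_chart_at Ac cx)).
Qed.

End VectorFields.

(** * Local bisections and the transport of vector fields *)

Lemma choose_inP (T : Type) (x0 : T) (P : set T) :
  (exists x, P x) -> P (choose_in x0 P).
Proof.
by move=> exP; rewrite /choose_in; case: pselect => // h; exact: svalP (cid h).
Qed.

Lemma repP (R : realType) (n : nat) (M : manifold R n) (G : groupoid_data M)
    (j : jet G) :
  is_jet j -> bisection_at (jsource j) (rep j) /\ j = j1 (jsource j) (rep j).
Proof.
move=> [b bj jE].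
apply: (choose_inP _ (P := [set b | bisection_at (jsource j) b /\
                                    j = j1 (jsource j) b])).
by exists b.
Qed.

Section Bisections.
Variables (R : realType) (n : nat) (M : manifold R n).
Implicit Types (c d e : chart R M n) (x y : M) (X Y : vfield M).
Implicit Types (a b : local_map (B1 M)).

(** A one-sided inverse of the base map that is smooth on its open image
    converts germs at [x] into germs at [base_map b x]; the statements below
    about germs of fields transported by [b] rest on it. *)
Lemma bisection_inv (G : groupoid_data M) (b : local_map G) x :
  bisection_at x b -> exists g : M -> M,
  [/\ forall z, ldom b z -> g (base_map b z) = z,
      forall P : M -> Prop, (\forall z \near x, P z) ->
        \forall y \near base_map b x, P (g y),
      \forall y \near base_map b x, ldom b (g y) /\ base_map b (g y) = y &
      forall c, atlas M c -> cdom c x ->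
        smoothM_at (base_map b x) (fun y => c (g y))].
Proof.
move=> [[_ _ _ oim [g sg gK]] bx].
have bbx : (base_map b @` ldom b) (base_map b x) by exists x.
exists g; split=> //.
- have gc := smooth_map_continuous sg bbx.
  by move=> P; rewrite -{1}(gK x bx) => nP; exact: (gc _ nP).
- have : nbhs (base_map b x) (base_map b @` ldom b) by exact: open_nbhs_nbhs.
  by apply: filterS => y [z bz <-]; rewrite gK.
- by move=> c Ac cx; apply: (smooth_map_coord sg bbx) => //; rewrite gK.
Qed.

Lemma near_bisection (G : groupoid_data M) (b : local_map G) x :
  bisection_at x b -> \forall z \near x, bisection_at z b.
Proof.
move=> [bb bx]; have [[ob _] _ _ _ _] := bb.
have : nbhs x (ldom b) by exact: open_nbhs_nbhs.
by apply: filterS.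
Qed.

Lemma base_map_continuous (G : groupoid_data M) (b : local_map G) x :
  bisection_at x b -> {for x, continuous (base_map b)}.
Proof. by move=> [[_ _ sb _ _] bx]; exact: smooth_map_continuous sb bx. Qed.

Lemma base_map_coord (G : groupoid_data M) (b : local_map G) d x :
  bisection_at x b -> atlas M d -> cdom d (base_map b x) ->
  smoothM_at x (fun z => d (base_map b z)).
Proof. by move=> [[_ _ sb _ _] bx]; exact: smooth_map_coord sb bx. Qed.

Lemma alongE b x (F : M -> 'rV[R]_n) :
  bisection_at x b -> along b F (base_map b x) = F x.
Proof.
move=> [[_ _ _ _ [g _ gK]] bx]; rewrite /along.
case: pselect => [h|[]]; last by exists x.
case: (cid h) => z [bz bzx] /=.
by rewrite -(gK _ bz) bzx gK.
Qed.

Lemma pushE b x Y : bisection_at x b ->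
  push b Y (base_map b x) = iso_app (b x) (Y x).
Proof. exact: alongE. Qed.

Lemma near_along b x (F F' : M -> 'rV[R]_n) :
  bisection_at x b -> (\forall z \near x, F z = F' z) ->
  \forall y \near base_map b x, along b F y = along b F' y.
Proof.
move=> bx FF'; have [bb ldx] := bx.
have [g [gK gc gb _]] := bisection_inv bx.
apply: filterS (filterI (gc _ FF') gb) => y [Fy [ldy gy]].
by rewrite -gy !alongE.
Qed.

(** The matrix of [xi] with respect to the bases that [c] and [d] give at its
    source and at its target. *)
Definition iso_matrix c d (xi : B1 M) : 'M[R]_n :=
  invmx (dcoord c (isrc xi)) *m imat xi *m dcoord d (itgt xi).

Lemma iso_matrix_fchart c d (xi : B1 M) :
  vec_mx (rsubmx (iso_fchart c d xi)) = iso_matrix c d xi.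
Proof. by rewrite /= row_mxKr mxvecK. Qed.

Lemma iso_matrix_rechart c c' d d' (xi : B1 M) x y :
  isrc xi = x -> itgt xi = y ->
  atlas M c -> atlas M c' -> atlas M d -> atlas M d' ->
  cdom c x -> cdom c' x -> cdom d y -> cdom d' y ->
  trans c c' x *m iso_matrix c' d' xi *m trans d' d y = iso_matrix c d xi.
Proof.
move=> sx ty Ac Ac' Ad Ad' cx c'x dy d'y.
rewrite /iso_matrix sx ty (transE Ac Ac' cx c'x) -(dcoord_trans Ad' Ad d'y dy).
move: (dcoord_unit Ac' c'x) (dcoord c _) (dcoord d' _) (trans d' d _).
by move: (dcoord c' _) => B uB A C D; rewrite !mulmxA (mulmxK uB).
Qed.

(** Smoothness of [b] only provides some pair of charts; [iso_matrix_rechart]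
    and the smoothness of the transition matrices extend it to all pairs. *)
Lemma bisection_fchart b c d x :
  bisection_at x b -> atlas M c -> cdom c x ->
  atlas M d -> cdom d (base_map b x) ->
  smoothM_at x (fun z => iso_fchart c d (b z)).
Proof.
move=> bx Ac cx Ad dbx; have [[sb srcb _ _ _] ldx] := bx.
have [e [Be ne se]] := smooth_map_at sb ldx; move: Be.
move=> [_ [c' [d' [Ac' Ad' ->]]] eE]; subst e.
have [c'x d'y] := nbhs_singleton ne.
have sbd := base_map_coord bx Ad dbx; rewrite /= in c'x d'y.
have sm := smoothM_at_linear (@vec_mx R n n)
  (smoothM_at_linear (@rsubmx R 1 n (n * n))
    (smoothM_at_linear (@rsubmx R 1 n (n + n * n)) se)).
have sbx : isrc (b x) = x by exact: srcb.
rewrite sbx in c'x.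
have sT : smoothM_at x (fun z => trans d' d (itgt (b z))).
  have sJ := smooth_at_jacobian (transition_smooth Ad' Ad d'y dbx).
  exact: smoothM_at_comp (base_map_coord bx Ad' d'y) sJ.
have := smoothM_atM (smoothM_atM (trans_smooth Ac Ac' cx c'x) sm) sT.
move=> /(smoothM_at_linear (@mxvec R n n))/(smoothM_at_row_mx sbd).
apply: smoothM_at_ext.
have nd : \forall z \near x, cdom d (base_map b z).
  exact: (base_map_continuous bx (near_cdom Ad dbx)).
have nb := near_bisection bx.
apply: filterS (filterI (filterI ne nd) (filterI (near_cdom Ac cx) nb)).
move=> z [[[c'z d'z] dz] [cz bz]].
have [[_ srcb' _ _ _] ldz] := bz; have sbz : isrc (b z) = z by exact: srcb'.
rewrite /= sbz in c'z d'z.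
have E : vec_mx (rsubmx (rsubmx (row_mx (c' (isrc (b z)))
    (iso_fchart c' d' (b z) : 'rV_(n + n * n))))) = iso_matrix c' d' (b z).
  by rewrite row_mxKr; exact: iso_matrix_fchart.
have E' := iso_matrix_rechart sbz erefl Ac Ac' Ad Ad' cz c'z dz d'z.
apply: (congr1 (fun A => row_mx (d (itgt (b z))) (mxvec A))).
apply: etrans E'.
exact: (congr1 (fun A => trans c c' z *m A *m trans d' d (itgt (b z))) E).
Qed.

End Bisections.

Section Push.
Variables (R : realType) (n : nat) (M : manifold R n).
Implicit Types (c d : chart R M n) (x y : M) (X Y : vfield M).
Implicit Types (b : local_map (B1 M)).

Lemma push_coord b c d z Y :
  bisection_at z b -> atlas M c -> cdom c z ->
  push b Y (base_map b z) *m dcoord d (base_map b z) =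
  (Y z *m dcoord c z) *m iso_matrix c d (b z).
Proof.
move=> bz Ac cz; have [[_ srcb _ _ _] ldz] := bz.
have sbz : isrc (b z) = z by exact: srcb.
rewrite (pushE _ bz) /iso_app /iso_matrix sbz /base_map /=.
move: (dcoord_unit Ac cz); move: (dcoord c z) (dcoord d _) => A B uA.
by rewrite !mulmxA (mulmxK uA).
Qed.

Lemma iso_matrix_smooth b c d x :
  bisection_at x b -> atlas M c -> cdom c x ->
  atlas M d -> cdom d (base_map b x) ->
  smoothM_at x (fun z => iso_matrix c d (b z)).
Proof.
move=> bx Ac cx Ad dbx.
have := smoothM_at_linear (@vec_mx R n n) (smoothM_at_linear
  (@rsubmx R 1 n (n * n)) (bisection_fchart bx Ac cx Ad dbx)).
by apply: smoothM_at_ext; apply: nearW => z; exact: iso_matrix_fchart.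
Qed.

(** The field [push b Y] is the composite of the local inverse of the base map
    with [z |-> b(z) Y_z], whose components [push_coord] computes. *)
Lemma push_smooth b c d x Y :
  bisection_at x b -> atlas M c -> cdom c x ->
  atlas M d -> cdom d (base_map b x) ->
  smoothM_at x (fun z => Y z *m dcoord c z) ->
  smoothM_at (base_map b x) (fun y => push b Y y *m dcoord d y).
Proof.
move=> bx Ac cx Ad dbx sY; have [g [gK gc gb sg]] := bisection_inv bx.
have gbx : g (base_map b x) = x by apply: gK; case: bx.
pose K z := (Y z *m dcoord c z) *m iso_matrix c d (b z).
have sK : smoothM_at x K by exact: smoothM_atM (iso_matrix_smooth _ _ _ _ _).
have /(smoothM_atP _ Ac cx) sKc := sK.
have sKg : smoothM_at (base_map b x) (fun y => K (cinv c (c (g y)))).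
  by apply: (smoothM_at_comp (sg c Ac cx) (g := fun u => K (cinv c u)));
    rewrite gbx.
apply: smoothM_at_ext sKg.
have nc := gc _ (near_cdom Ac cx); have nb := gc _ (near_bisection bx).
apply: filterS (filterI (filterI nc nb) gb) => y [[cgy bgy] [_ gy]].
rewrite (cinvK Ac cgy) -[in RHS]gy; apply/esym; exact: push_coord.
Qed.

End Push.

(** * The connection of a symmetry jet *)

Section Connection.
Variables (R : realType) (n : nat) (M : manifold R n).
Variables (s : M -> B11 M) (hs : symmetry_jet s).
Implicit Types (c d : chart R M n) (x y : M) (X Y : vfield M).

(** The tangent map is $-1$ because $p = p_*$ at the jet [s x], whose $p$ is
    $-1$. *)
Lemma rep_symmetry x :
  [/\ bisection_at x (rep (s x)), rep (s x) x = minus_id x &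
      tangent_map (base_map (rep (s x))) x = - 1%:M].
Proof.
have [_ srcs shs ps] := hs.
have sx : jsource (s x) = x by exact: srcs.
have [[b0 b0x sb0] pst] := shs x.
have [br sr] := repP (ex_intro2 _ _ b0 b0x sb0).
have vx : rep (s x) x = minus_id x.
  have jv := congr1 (@jvalue R n M (B1 M)) sr.
  by rewrite -(ps x) -{2}sx; exact: esym jv.
rewrite sx in br; split; [exact: br | exact: vx |].
by rewrite /jet_p_star sx (ps x) in pst; exact: esym pst.
Qed.

Definition sym_defect x Y : vfield M := fun y => Y y + push (rep (s x)) Y y.

Lemma base_rep x : base_map (rep (s x)) x = x.
Proof. by have [_ rx _] := rep_symmetry x; rewrite /base_map rx. Qed.

Lemma sym_defect0 x Y : sym_defect x Y x = 0.
Proof.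
have [bx rx _] := rep_symmetry x.
rewrite /sym_defect -{3}(base_rep x) (pushE _ bx) rx.
by rewrite /iso_app /= mulmxN mulmx1 subrr.
Qed.

(** [Y + s_x Y] vanishes at [x], so only one term of the bracket survives: this
    is why the connection is tensorial in its first argument. *)
Lemma nablaE X Y x : nabla s X Y x =
  2^-1 *: 'd (components (chart_at x) (sym_defect x Y)) (chart_at x x) (X x).
Proof.
apply: (congr1 (fun w => 2^-1 *: w)); apply: bracket_zero.
exact: sym_defect0.
Qed.

Lemma nabla_atE (v : 'rV[R]_n) Y x : nabla_at s x v Y =
  2^-1 *: 'd (components (chart_at x) (sym_defect x Y)) (chart_at x x) v.
Proof.
apply: etrans (nablaE _ _ _) _.
apply: (congr1 (fun w => 2^-1 *: 'd _ _ w)).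
by rewrite /extend dcoord_chart_at invmx1 mulmx1.
Qed.

Lemma nabla_at_nabla X Y x : nabla_at s x (X x) Y = nabla s X Y x.
Proof. exact: etrans (nabla_atE _ _ _) (esym (nablaE _ _ _)). Qed.

(** A change of [Y] away from [x] does not affect [s_xY] near [x], since the
    base map of $s_x$ fixes [x]. *)
Lemma nabla_at_near x (v : 'rV[R]_n) Y Y' :
  (\forall y \near x, Y y = Y' y) -> nabla_at s x v Y = nabla_at s x v Y'.
Proof.
move=> YY'; apply: etrans (nabla_atE _ _ _) _.
apply: etrans _ (esym (nabla_atE _ _ _)).
have [A0 x0] := chart_atP x; have [bx rx _] := rep_symmetry x.
have pYY' : \forall z \near x, iso_app (rep (s x) z) (Y z) =
                               iso_app (rep (s x) z) (Y' z).
  by apply: filterS YY' => z ->.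
have := near_along bx pYY'; rewrite base_rep => nY.
have E : \forall y \near x, sym_defect x Y y = sym_defect x Y' y.
  by apply: filterS (filterI YY' nY) => y [Yy Py]; congr (_ + _).
apply: (congr1 (fun w => 2^-1 *: w)); apply: (congr1 (@^~ v) (diff_near_eq _)).
by apply: filterS (near_cinv A0 x0 E) => u; rewrite /components => ->.
Qed.

End Connection.

Section ConnectionCoordinates.
Variables (R : realType) (n : nat) (M : manifold R n).
Variables (s : M -> B11 M) (hs : symmetry_jet s).
Implicit Types (c d : chart R M n) (x y : M) (X Y : vfield M).

(** The derivative in the direction [v] of the matrix of $s_x$.  For [c = d] it
    is $-2$ times the matrix of Christoffel symbols contracted with [v], by
    [nabla_coord] below. *)
Definition sym_christoffel c d x (v : 'rV[R]_n) : 'M[R]_n :=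
  vec_mx (rsubmx (v *m (differential_in (G := B1 M) (iso_fchart c d) (rep (s x)) x
                          : 'M[R]_(n, n + n * n)))).

Lemma rep_jacobian c d x :
  atlas M c -> cdom c x -> atlas M d -> cdom d x ->
  jacobian (fun u => d (base_map (rep (s x)) (cinv c u))) (c x) =
  - trans c d x.
Proof.
move=> Ac cx Ad dx; have [[[_ _ sb _ _] ldx] _ tx] := rep_symmetry hs x.
have bx := base_rep hs x.
have dbx : cdom d (base_map (rep (s x)) x) by rewrite bx.
have := smooth_map_coord_jacobian sb ldx Ac cx Ad dbx.
rewrite tx bx mulmxN mulmx1 mulNmx => J; apply: etrans J _.
exact: (congr1 (fun A => - A) (esym (transE Ac Ad cx dx))).
Qed.

Lemma rep_iso_matrix c d x :
  atlas M c -> cdom c x -> atlas M d -> cdom d x ->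
  iso_matrix c d (rep (s x) x) = - trans c d x.
Proof.
move=> Ac cx Ad dx; have [_ rx _] := rep_symmetry hs x.
rewrite rx /iso_matrix /= mulmxN mulmx1 mulNmx.
exact: (congr1 (fun A => - A) (esym (transE Ac Ad cx dx))).
Qed.

Lemma rep_iso_matrix_diff c d x (v : 'rV[R]_n) :
  atlas M c -> cdom c x -> atlas M d -> cdom d x ->
  differentiable (fun u => iso_matrix c d (rep (s x) (cinv c u))) (c x) /\
  'd (fun u => iso_matrix c d (rep (s x) (cinv c u))) (c x) v =
  sym_christoffel c d x v.
Proof.
move=> Ac cx Ad dx; have [br _ _] := rep_symmetry hs x.
have dbx : cdom d (base_map (rep (s x)) x) by rewrite base_rep.
pose I u : 'rV[R]_(n + n * n) := iso_fchart c d (rep (s x) (cinv c u)).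
have dI : differentiable I (c x).
  apply: smooth_at_differentiable.
  by have /(smoothM_atP _ Ac cx) := bisection_fchart br Ac cx Ad dbx.
have d1 := is_diff_linear_mx (@rsubmx R 1 n (n * n)) dI.
have d2 := is_diff_linear_mx (@vec_mx R n n) (@ex_diff _ _ _ _ _ _ _ d1).
have E : (vec_mx \o (rsubmx \o I)) =
         (fun u => iso_matrix c d (rep (s x) (cinv c u))).
  by apply/funext => u; exact: iso_matrix_fchart.
rewrite -E; split; first exact: (@ex_diff _ _ _ _ _ _ _ d2).
apply: etrans (congr1 (@^~ v) (@diff_val _ _ _ _ _ _ _ d2)) _.
apply: (congr1 (@vec_mx R n n)).
apply: etrans (congr1 (@^~ v) (@diff_val _ _ _ _ _ _ _ d1)) _.
exact: (congr1 (@rsubmx R 1 n (n * n)) (diff_jacobian I (c x) v)).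
Qed.

(** Differentiate $(s_xY)_{s_x^0(z)} = s_x(z)Y_z$ at the fixed point $z = x$ of
    the base map $s_x^0$, where both $s_x(z)$ and the derivative of $s_x^0$ are
    $-1$. *)
Lemma push_rep_diff c d x Y (v : 'rV[R]_n) :
  atlas M c -> cdom c x -> atlas M d -> cdom d x ->
  smoothM_at x (fun y => Y y *m dcoord c y) ->
  'd (components d (push (rep (s x)) Y)) (d x) (v *m trans c d x) =
  'd (components c Y) (c x) v *m trans c d x -
  (Y x *m dcoord c x) *m sym_christoffel c d x v.
Proof.
move=> Ac cx Ad dx sY; have [bx rx _] := rep_symmetry hs x.
set b := rep (s x) in bx rx *.
have b0x : base_map b x = x by exact: base_rep.
have dbx : cdom d (base_map b x) by rewrite b0x.
pose beta u := d (base_map b (cinv c u)).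
pose P := components d (push b Y).
pose B u := iso_matrix c d (b (cinv c u)).
have betax : beta (c x) = d x by rewrite /beta (cinvK Ac cx) b0x.
have dbeta : differentiable beta (c x).
  apply: smooth_at_differentiable.
  by have /(smoothM_atP _ Ac cx) := base_map_coord bx Ad dbx.
have dP : differentiable P (beta (c x)).
  rewrite betax; apply: smooth_at_differentiable.
  apply/(smooth_components _ Ad dx); rewrite -[X in smoothM_at X]b0x.
  exact: push_smooth bx Ac cx Ad dbx sY.
have dY : differentiable (components c Y) (c x).
  by apply: smooth_at_differentiable; apply/(smooth_components _ Ac cx).
have [dB dBv] := rep_iso_matrix_diff v Ac cx Ad dx.
have E : \forall u \near c x, (P \o beta) u = components c Y u *m B u.
  have nd : \forall z \near x, cdom d (base_map b z).
    exact: (base_map_continuous bx (near_cdom Ad dbx)).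
  have nb := near_bisection bx.
  have {}nd := near_cinv Ac cx nd; have {}nb := near_cinv Ac cx nb.
  apply: filterS (filterI (filterI nd nb) (near_image Ac cx)).
  move=> u [[du bu] [cu _]].
  rewrite /P /beta /= /components (cinvK Ad du).
  exact: push_coord bu Ac cu.
have Yx : components c Y (c x) = Y x *m dcoord c x.
  by rewrite /components (cinvK Ac cx).
have Bx : B (c x) = - trans c d x.
  by rewrite /B (cinvK Ac cx); exact: rep_iso_matrix.
(* both sides of E differentiated, by the chain rule and by the product rule *)
have H := etrans (esym (diff_comp_jacobian v dbeta dP))
  (etrans (congr1 (@^~ v) (diff_near_eq E)) (diff_mulmx v dY dB)).
rewrite betax in H; have J := rep_jacobian Ac cx Ad dx.
have {}H := etrans (esym (congr1 (fun A => 'd P (d x) (v *m A)) J)) H.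
have {}H := etrans H (congr1 (fun A => _ *m _ + _ *m A) Bx).
have {}H := etrans H (congr1 (fun A => _ *m A + _ *m _) dBv).
have {}H := etrans H (congr1 (fun A => A *m _ + _ *m _) Yx).
have alg (L : {linear 'rV[R]_n -> 'rV[R]_n}) (T : 'M[R]_n) (A D : 'rV[R]_n) :
    L (v *m - T) = A + D *m - T -> L (v *m T) = D *m T - A.
  by rewrite !mulmxN linearN => LE; rewrite -[LHS]opprK LE opprD opprK addrC.
exact: alg H.
Qed.

(** The source chart [c] and the target chart [d] are kept apart because the
    smoothness of [s] at a point provides a pair of charts, possibly distinct. *)
Lemma nabla_coord c d x X Y :
  atlas M c -> cdom c x -> atlas M d -> cdom d x -> smooth_vfield Y ->
  nabla s X Y x *m dcoord d x =
  2^-1 *: ((X x *m dcoord d x) *m jacobian (components d Y) (d x) +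
           ((X x *m dcoord c x) *m jacobian (components c Y) (c x) *m
              trans c d x -
            (Y x *m dcoord c x) *m sym_christoffel c d x (X x *m dcoord c x))).
Proof.
move=> Ac cx Ad dx sY; have [bx rx _] := rep_symmetry hs x.
set b := rep (s x) in bx rx *.
have b0x : base_map b x = x by exact: base_rep.
have dbx : cdom d (base_map b x) by rewrite b0x.
have sYd := smooth_vfield_at sY Ad dx; have sYc := smooth_vfield_at sY Ac cx.
have sP : smoothM_at x (fun y => push b Y y *m dcoord d y).
  by rewrite -[X in smoothM_at X]b0x; exact: push_smooth bx Ac cx Ad dbx sYc.
have sN : smoothM_at x (fun y => sym_defect s x Y y *m dcoord d y).
  apply: smoothM_at_ext (smoothM_atD sYd sP).
  by apply: nearW => y; rewrite mulmxDl.
have dYd : differentiable (components d Y) (d x).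
  by apply: smooth_at_differentiable; apply/(smooth_components _ Ad dx).
have dPd : differentiable (components d (push b Y)) (d x).
  by apply: smooth_at_differentiable; apply/(smooth_components _ Ad dx).
have N0 := sym_defect0 hs x Y.
have ND : components d (sym_defect s x Y) =
          components d Y + components d (push b Y).
  by apply/funext => u; rewrite /components /= mulmxDl.
rewrite (nablaE hs) -scalemxAl; apply: (congr1 (fun w => 2^-1 *: w)).
apply: etrans (diff_components_zero (X x) Ad dx sN N0) _.
apply: etrans (congr1 (fun f => 'd f (d x) _) ND) _.
apply: etrans (congr1 (@^~ _) (diffD dYd dPd)) _.
have Xc : X x *m dcoord c x *m trans c d x = X x *m dcoord d x.
  by rewrite -mulmxA (dcoord_trans Ac Ad cx dx).
have Pv := push_rep_diff (X x *m dcoord c x) Ac cx Ad dx sYc.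
rewrite Xc in Pv.
apply: etrans (congr1 (fun w => 'd (components d Y) (d x) _ + w) Pv) _.
apply: etrans (congr1 (fun w => w + _) (diff_jacobian _ _ _)) _.
apply: (congr1 (fun w => _ + (w *m _ - _))).
exact: diff_jacobian.
Qed.

End ConnectionCoordinates.

Section Smoothness.
Variables (R : realType) (n : nat) (M : manifold R n).
Variables (s : M -> B11 M) (hs : symmetry_jet s).
Implicit Types (c d : chart R M n) (x y : M) (X Y : vfield M).

(** This reads the last component of the coordinates of the jet [s y]; both of
    its charts contain [x] because [s x] extends the element [minus_id x]. *)
Lemma symmetry_jet_smooth x : exists c d,
  [/\ atlas M c, cdom c x, atlas M d, cdom d x &
      smoothM_at x (fun y => differential_in (G := B1 M) (iso_fchart c d)
                               (rep (s y)) y : 'M[R]_(n, n + n * n))].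
Proof.
have [ss srcs _ ps] := hs.
have [e [Be ne se]] := smooth_map_at (x := x) ss I; move: Be.
move=> [_ [_ [c [d [Ac Ad ->]]] ->] eE]; subst e.
have [_ [cx dx]] := nbhs_singleton ne.
exists c, d.
have jx : jvalue (s x) = minus_id x by exact: ps.
rewrite jx /= in cx dx; split; [exact: Ac | exact: cx | exact: Ad | exact: dx |].
have := smoothM_at_linear (@vec_mx R n (n + n * n))
  (smoothM_at_linear (@rsubmx R 1 (n + n * n) (n * (n + n * n)))
    (smoothM_at_linear (@rsubmx R 1 n ((n + n * n) + n * (n + n * n))) se)).
apply: smoothM_at_ext; apply: nearW => y.
have sy : jsource (s y) = y by exact: srcs.
apply: etrans (congr1 (@vec_mx R n (n + n * n)) _) _.
  apply: etrans (congr1 (@rsubmx R 1 (n + n * n) (n * (n + n * n))) _) _.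
    exact: row_mxKr.
  exact: row_mxKr.
by rewrite mxvecK sy.
Qed.

Lemma smooth_nabla X Y :
  smooth_vfield X -> smooth_vfield Y -> smooth_vfield (nabla s X Y).
Proof.
move=> sX sY; apply: smooth_vfieldI => x.
have [c [d [Ac cx Ad dx sG]]] := symmetry_jet_smooth x.
exists d; split; [exact: Ad | exact: dx |].
have sXc := smooth_vfield_at sX Ac cx; have sXd := smooth_vfield_at sX Ad dx.
have sJ e : atlas M e -> cdom e x ->
    smoothM_at x (fun y => jacobian (components e Y) (e y)).
  move=> Ae ex; apply: (smoothM_at_coord Ae ex); apply: smooth_at_jacobian.
  exact: (proj1 (smooth_components _ Ae ex) (smooth_vfield_at sY Ae ex)).
have s1 := smoothM_atM sXd (sJ d Ad dx).
have s2 := smoothM_atM (smoothM_atM sXc (sJ c Ac cx)) (trans_smooth Ac Ad cx dx).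
have sC := smoothM_at_linear (@vec_mx R n n) (smoothM_at_linear
  (@rsubmx R 1 n (n * n)) (smoothM_atM sXc sG)).
have s3 := smoothM_at_linear (@GRing.opp 'rV[R]_n)
  (smoothM_atM (smooth_vfield_at sY Ac cx) sC).
have := smoothM_at_linear (@GRing.scale R 'rV[R]_n 2^-1)
  (smoothM_atD s1 (smoothM_atD s2 s3)).
apply: smoothM_at_ext.
apply: filterS (filterI (near_cdom Ac cx) (near_cdom Ad dx)) => y [cy dy].
exact/esym/(nabla_coord hs X Ac cy Ad dy sY).
Qed.

End Smoothness.

(** * Affine lifts *)

Section Lifts.
Variables (R : realType) (n : nat) (M : manifold R n).
Implicit Types (c d : chart R M n) (x y : M) (X Y Z T : vfield M).

(** The base map is invertible near [x], so its Jacobian is an invertible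
    matrix, and the zero matrix of positive size is not. *)
Lemma bisection_jacobian_neq0 (G : groupoid_data M) (b : local_map G) c d x :
  (0 < n)%N -> bisection_at x b -> atlas M c -> cdom c x ->
  atlas M d -> cdom d (base_map b x) ->
  jacobian (fun u => d (base_map b (cinv c u))) (c x) <> 0.
Proof.
move=> n0 bx Ac cx Ad dbx J0.
have [g [gK gc gb sg]] := bisection_inv bx.
pose beta u := d (base_map b (cinv c u)); pose gamma v := c (g (cinv d v)).
have dbeta : differentiable beta (c x).
  apply: smooth_at_differentiable.
  by have /(smoothM_atP _ Ac cx) := base_map_coord bx Ad dbx.
have dgamma : differentiable gamma (beta (c x)).
  rewrite /beta (cinvK Ac cx); apply: smooth_at_differentiable.
  by have /(smoothM_atP _ Ad dbx) := sg c Ac cx.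
have E : \forall u \near c x, (gamma \o beta) u = id u.
  have nd : \forall z \near x, cdom d (base_map b z).
    exact: (base_map_continuous bx (near_cdom Ad dbx)).
  have {}nd := near_cinv Ac cx nd.
  have nb := near_cinv Ac cx (near_bisection bx).
  apply: filterS (filterI (filterI nd nb) (near_image Ac cx)).
  move=> u [[du [_ bu]] [_ cu]].
  by rewrite /gamma /beta /= (cinvK Ad du) (gK _ bu) cu.
have J1 : jacobian (gamma \o beta) (c x) = 1%:M.
  exact: etrans (near_eq_jacobian (g := id) E) (jacobian_id _).
have J2 := jacobian_comp dbeta dgamma.
have J3 := congr1 (fun A => A *m jacobian gamma (beta (c x))) J0.
have := etrans (esym J1) (etrans J2 J3).
rewrite mul0mx => /matrixP/(_ (Ordinal n0) (Ordinal n0)).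
by rewrite !mxE eqxx => /eqP; rewrite oner_eq0.
Qed.

(** The coordinates of a bisection determine those of its base map, so their
    derivative cannot vanish. *)
Lemma not_contact_cst (a : local_map (B1 M)) (xi : B1 M) x :
  (0 < n)%N -> bisection_at x a -> a x = xi ->
  ~ contact1 x (LocalMap set0 (fun=> xi)) a.
Proof.
move=> n0 ba ax [_ dE].
have [Ac cx] := chart_atP x; have [Ad dy] := chart_atP (base_map a x).
set c := chart_at x in Ac cx *; set d := chart_at _ in Ad dy *.
pose I u : 'rV[R]_(n + n * n) := iso_fchart c d (a (cinv c u)).
have ldx : source (a x) = x by have [[_ srcb _ _ _] ldx] := ba; exact: srcb.
have J0 : jacobian I (c x) = 0.
  have cd : fatlas (B1 M) (iso_fchart c d) by exists c, d.
  have xid : cdom (iso_fchart c d) xi.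
    by rewrite -ax; split; [move: ldx => /= -> | ].
  apply: etrans (esym (dE _ cd xid)) _.
  exact: (jacobian_cst (iso_fchart c d xi : 'rV[R]_(n + n * n)) (c x)).
have dI : differentiable I (c x).
  apply: smooth_at_differentiable.
  by have /(smoothM_atP _ Ac cx) := bisection_fchart ba Ac cx Ad dy.
apply: (bisection_jacobian_neq0 n0 ba Ac cx Ad dy).
have d1 := is_diff_linear_mx (@lsubmx R 1 n (n * n)) dI.
have E : lsubmx \o I = (fun u => d (base_map a (cinv c u))).
  by apply/funext => u; exact: row_mxKl.
have H v : 'd (fun u => d (base_map a (cinv c u))) (c x) v = 0.
  apply: etrans (congr1 (fun f => 'd f (c x) v) (esym E)) _.
  apply: etrans (congr1 (@^~ v) (@diff_val _ _ _ _ _ _ _ d1)) _.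
  apply: etrans (congr1 (@lsubmx R 1 n (n * n)) (diff_jacobian I (c x) v)) _.
  apply: etrans (congr1 (fun A => lsubmx (v *m A)) J0) _.
  by rewrite mulmx0 linear0.
apply/row_matrixP => i; rewrite (rowE i (jacobian _ _)) row0.
exact: etrans (esym (diff_jacobian _ _ _)) (H _).
Qed.

Variable s : M -> B11 M.

(** If [xi] had no affine extension, [affine_ext s xi] would be the contact class
    of a constant map, and the lift [a] would belong to it. *)
Lemma is_lift_affine (xi : B1 M) (a : local_map (B1 M)) :
  (0 < n)%N -> is_lift s xi a ->
  forall (v : 'rV[R]_n) Y, smooth_vfield Y ->
  iso_app xi (nabla_at s (source xi) v Y) =
  nabla_at s (target xi) (iso_app xi v) (push a Y).
Proof.
move=> n0 [ba ax ja] v Y sY.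
have [h|nh] := pselect (exists j, [/\ B11sh j, jet_p j = xi & affine11 s j]).
  have [_ _ aff] := choose_inP
    (j1 (source xi) (LocalMap set0 (fun=> xi)) : B11 M)
    (P := [set j | [/\ B11sh j, jet_p j = xi & affine11 s j]]) h.
  move: aff; rewrite -/(affine_ext s xi) -ja => aff.
  have := aff a ba erefl v Y sY.
  by rewrite /jet_p /= ax.
case: (not_contact_cst n0 ba ax).
have jE : affine_ext s xi = j1 (source xi) (LocalMap set0 (fun=> xi)).
  by rewrite /affine_ext /choose_in; case: pselect.
have : jclass (j1 (source xi) a) a by split=> //; split.
by rewrite ja jE => -[].
Qed.

End Lifts.

Theorem proposition8p5 (R : realType) (n : nat) (M : manifold R n)
    (s : M -> B11 M) (hs : symmetry_jet s) (xi : B1 M)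
    (a : local_map (B1 M)) (ha : is_lift s xi a) :
  affine1111 s xi (S1111 s xi a).
Proof.
move=> b b2 b3 hb [_ hb2] [_ hb3] _ X Y Z T _ sY sZ sT; pose x := source xi.
move=> U V W.
have [n0|n0] := posnP n.
  by apply/rowP => -[i i_n]; exfalso; rewrite n0 in i_n.
have sZT := smooth_nabla hs sZ sT; have sYZT := smooth_nabla hs sY sZT.
have srcE (e : local_map (B1 M)) z : bisection_at z e -> source (e z) = z.
  by move=> [[_ srce _ _ _] ldz]; exact: srce.
have [bb bx _] := hb.
have V_push : \forall x1 \near x,
    nabla_at s (target (b x1)) (iso_app (b x1) (Y x1)) (V x1) =
    iso_app (b x1) (nabla s Y (nabla s Z T) x1).
  apply: filterS (filterI (filterI hb2 hb3) (near_bisection bb)).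
  move=> x1 [[l2 l3] bbx1]; have sx1 := srcE b x1 bbx1.
  have [bb2 b2x1 _] := l2; rewrite sx1 in bb2 b2x1.
  have U_push : \forall x2 \near x1,
      nabla_at s (target (b2 x1 x2)) (iso_app (b2 x1 x2) (Z x2)) (U x1 x2) =
      iso_app (b2 x1 x2) (nabla s Z T x2).
    apply: filterS (filterI l3 (near_bisection bb2)) => x2 [l bbx2].
    apply: etrans (esym (is_lift_affine n0 l (Z x2) sT)) _.
    by rewrite (srcE _ _ bbx2) (nabla_at_nabla hs Z T x2).
  have := near_along bb2 U_push; rewrite /base_map b2x1 => VE.
  apply: etrans (nabla_at_near hs _ VE) _.
  apply: etrans (esym (is_lift_affine n0 l2 (Y x1) sZT)) _.
  by rewrite sx1 (nabla_at_nabla hs Y (nabla s Z T) x1).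
have := near_along bb V_push; rewrite /base_map bx => WE.
apply: etrans (is_lift_affine n0 hb (X x) sYZT) _.
exact/esym/(nabla_at_near hs _ WE).
Qed.
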